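(* Let $\mathcal{P}_c^+$ denote the set of all compactly supported Borel probability measures on $[0,\infty)$. For every $\sigma_1,\sigma_2\in\mathcal{P}_c^+$ there exists a unique $\eta$-diagonal $*$-distribution $\mu\in\mathcal{D}_c(1,* )$ such that the distributions of $ZZ^*$ and $Z^*Z$ in $(\mathbb{C}\langle Z,Z^*\rangle,\mu)$ are $\sigma_1$ and $\sigma_2$ respectively, i.e. $$\mu((ZZ^* )^n)=\int_0^\infty t^n\,d\sigma_1(t)\quad\text{and}\quad\mu((Z^*Z)^n)=\int_0^\infty t^n\,d\sigma_2(t),\qquad n\in\mathbb{N}.$$ Moreover, the map $$\Phi:\mathcal{P}_c^+\times\mathcal{P}_c^+\to\{\mu\in\mathcal{D}_c(1,* ):\mu\text{ is }\eta\text{-diagonal}\}$$ which sends $(\sigma_1,\sigma_2)$ to this $\mu$ is a bijection.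
   Context: $\mathbb{C}\langle Z,Z^*\rangle$ is the algebra of complex polynomials in two non-commuting variables. $\mathcal{W}^+=\bigsqcup_{n\ge1}\{1,*\}^n$ is the set of non-empty words over $\{1,*\}$; for $w=(\ell_1,\dots,\ell_n)$ let $Z^w=Z^{\ell_1}\cdots Z^{\ell_n}$, $a^w=a^{\ell_1}\cdots a^{\ell_n}$ (with $a^1=a$), $z^w=z^{\ell_1}\cdots z^{\ell_n}$ (non-commuting formal indeterminates $z,z^*$). A $C^*$-probability space $(\mathcal{A},\varphi)$ is a unital $C^*$-algebra with a positive linear functional $\varphi$, $\varphi(1)=1$ (not assumed to be a trace). The $*$-distribution of $a\in\mathcal{A}$ is the linear functional $\mu$ on $\mathbb{C}\langle Z,Z^*\rangle$ with $\mu(1)=1$ and $\mu(Z^w)=\varphi(a^w)$, $w\in\mathcal{W}^+$. $\mathcal{D}_c(1,* )$ is the set of all functionals that are $*$-distributions of some element of some $C^*$-probability space. The moment series of $\mu$ is $M_\mu=\sum_{w\in\mathcal{W}^+}\mu(Z^w)z^w$ and its $\eta$-series is $\eta_\mu=M_\mu(1+M_\mu)^{-1}$. $\mu$ is $\eta$-diagonal if the coefficient of $z^w$ in $\eta_\mu$ is $0$ for every $w\in\mathcal{W}^+$ not of the form $(1,* )^m$ or $( *,1)^m$, $m\ge1$ (powers with respect to concatenation). For every $\mu\in\mathcal{D}_c(1,* )$ there are unique $\sigma_1,\sigma_2\in\mathcal{P}_c^+$ whose moments are $\mu((ZZ^* )^n)$ and $\mu((Z^*Z)^n)$, $n\in\mathbb{N}$;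 these are called the distributions of $ZZ^*$ and $Z^*Z$ in $(\mathbb{C}\langle Z,Z^*\rangle,\mu)$. *)

(* Defs.v *)
From HB Require Import structures.
From mathcomp Require Import all_boot all_order all_algebra.
From mathcomp Require Import all_classical all_reals all_analysis.
From mathcomp Require Import complex.
(* The notations of monalg clash with those of mathcomp-analysis. *)
From mathcomp Require Import (canonicals, coercions) monalg.

Set Implicit Arguments.
Unset Strict Implicit.
Unset Printing Implicit Defensive.
Import Order.TTheory GRing.Theory Num.Theory.
Import numFieldNormedType.Exports.

Local Open Scope classical_set_scope.
Local Open Scope ring_scope.

(* Words over the alphabet {1, *}: [false] encodes the letter 1 and [true] the
   letter *. *)
Definition word := seq bool.

(* x^w, where x^1 = x and x^* = y *)
Definition wpow (A : nzRingType) (x y : A) (w : word) : A :=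
  \prod_(l <- w) (if l then y else x).

(* The m-th power of w with respect to concatenation. *)
Definition word_exp (w : word) (m : nat) : word := flatten (nseq m w).

(* C<Z, Z*> is the algebra of the free monoid on two letters. *)
Definition ncpoly (R : realType) : lalgType R[i] :=
  @monalg.malg (monalg.fmonom bool) R[i].

Definition ncZ (R : realType) : ncpoly R :=
  monalg.mkmalgU (monalg.fmu false) 1.
Definition ncZs (R : realType) : ncpoly R :=
  monalg.mkmalgU (monalg.fmu true) 1.

(* Unital C*-algebras. The normed structures of mathcomp-analysis are not used,
   since Hierarchy Builder rejects the missing join of a ring with a normed
   module; hence the norm and its completeness are fields. *)
HB.mixin Record isCStarAlgebra (R : realType) A
    of GRing.Algebra R[i] A := {
  cnorm : A -> R;
  star : A -> A;
  cnorm_eq0 : forall x : A, cnorm x = 0 -> x = 0;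
  cnormD : forall x y : A, cnorm (x + y) <= cnorm x + cnorm y;
  cnormZ : forall (c : R[i]) (x : A),
    (cnorm (c *: x))%:C%C = `|c| * (cnorm x)%:C%C;
  cnormM : forall x y : A, cnorm (x * y) <= cnorm x * cnorm y;
  cnorm_complete : forall u : nat -> A,
    (forall e : R, 0 < e -> exists N : nat, forall m n : nat,
       (N <= m)%N -> (N <= n)%N -> cnorm (u m - u n) < e) ->
    exists x : A, forall e : R, 0 < e -> exists N : nat, forall n : nat,
       (N <= n)%N -> cnorm (u n - x) < e;
  starK : involutive star;
  starD : {morph star : x y / x + y};
  starZ : forall (c : R[i]) (x : A), star (c *: x) = c^* *: star x;
  starM : forall x y : A, star (x * y) = star y * star x;
  cnorm_starM : forall x : A, cnorm (star x * x) = cnorm x ^+ 2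
}.

#[short(type="cstarAlgType")]
HB.structure Definition CStarAlgebra (R : realType) :=
  {A of GRing.Algebra R[i] A & isCStarAlgebra R A}.

Record cstar_prob_space (R : realType) := CStarProbSpace {
  cps_alg :> cstarAlgType R;
  cps_state : {scalar cps_alg};
  cps_state_ge0 : forall x : cps_alg, 0 <= cps_state (star x * x);
  cps_state1 : cps_state 1 = 1
}.

Definition star_distribution (R : realType) (P : cstar_prob_space R) (a : P)
    (mu : {scalar ncpoly R}) : Prop :=
  mu 1 = 1 /\
  forall w : word, w != [::] ->
    mu (wpow (ncZ R) (ncZs R) w) = cps_state P (wpow a (star a) w).

Definition Dc (R : realType) : set {scalar ncpoly R} :=
  [set mu | exists (P : cstar_prob_space R) (a : P), star_distribution a mu].

(* Formal power series in the non-commuting indeterminates z, z*, as functions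
   sending a word w to the coefficient of z^w. *)
Definition ncseries (K : nzRingType) : Type := word -> K.

HB.instance Definition _ (K : nzRingType) :=
  GRing.Zmodule.copy (ncseries K) (word -> K).

Section NCSeriesRing.
Variable K : nzRingType.
Implicit Types (f g h : ncseries K) (w : word).

Definition ncs_one : ncseries K := fun w => (w == [::])%:R.

Definition ncs_mul f g : ncseries K := fun w =>
  \sum_(i < (size w).+1) f (take i w) * g (drop i w).

Definition ncs_shift (l : bool) f : ncseries K := fun w => f (l :: w).

Lemma ncs_addE f g w : (f + g) w = f w + g w.
Proof. by []. Qed.

Lemma ncs_mul_nil f g : ncs_mul f g [::] = f [::] * g [::].
Proof. by rewrite /ncs_mul big_ord_recl big_ord0 addr0. Qed.

Lemma ncs_mul_cons f g l w :
  ncs_mul f g (l :: w) = f [::] * g (l :: w) + ncs_mul (ncs_shift l f) g w.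
Proof. by rewrite /ncs_mul big_ord_recl. Qed.

Fact ncs_mulDl : left_distributive ncs_mul +%R.
Proof.
move=> f g h; apply/funext => w; rewrite ncs_addE /ncs_mul -big_split /=.
by apply: eq_bigr => i _; rewrite ncs_addE mulrDl.
Qed.

Fact ncs_mulDr : right_distributive ncs_mul +%R.
Proof.
move=> f g h; apply/funext => w; rewrite ncs_addE /ncs_mul -big_split /=.
by apply: eq_bigr => i _; rewrite ncs_addE mulrDr.
Qed.

Fact ncs_mulA : associative ncs_mul.
Proof.
move=> f g h; apply/funext => w; elim: w f g h => [|l w IHw] f g h.
  by rewrite !ncs_mul_nil mulrA.
rewrite !ncs_mul_cons IHw ncs_mul_nil mulrDr mulrA -addrA; congr (_ + _).
set fg := ncs_shift l (ncs_mul f g).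
have -> : fg = (fun u => f [::] * ncs_shift l g u)
             + ncs_mul (ncs_shift l f) g.
  by apply/funext => u; rewrite /fg /ncs_shift ncs_mul_cons.
rewrite ncs_mulDl ncs_addE; congr (_ + _).
by rewrite /ncs_mul mulr_sumr; apply: eq_bigr => i _; rewrite mulrA.
Qed.

Fact ncs_mul1 : left_id ncs_one ncs_mul.
Proof.
move=> f; apply/funext; case=> [|l w].
  by rewrite ncs_mul_nil mul1r.
rewrite ncs_mul_cons mul1r [X in _ + X]big1 ?addr0 // => i _.
by rewrite mul0r.
Qed.

Fact ncs_mulr1 : right_id ncs_one ncs_mul.
Proof.
move=> f; apply/funext => w; elim: w f => [|l w IHw] f.
  by rewrite ncs_mul_nil mulr1.
by rewrite ncs_mul_cons mulr0 add0r IHw.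
Qed.

Fact ncs_one_neq0 : ncs_one != 0.
Proof.
apply/eqP => /(congr1 (fun f : ncseries K => f [::])) /eqP.
by rewrite oner_eq0.
Qed.

HB.instance Definition _ := GRing.Zmodule_isNzRing.Build (ncseries K)
  ncs_mulA ncs_mul1 ncs_mulr1 ncs_mulDl ncs_mulDr ncs_one_neq0.

Definition ncs_invertible f := exists g, g * f = 1 /\ f * g = 1.

Definition ncs_unit : {pred ncseries K} := fun f => `[< ncs_invertible f >].

Definition ncs_inv f : ncseries K :=
  if pselect (ncs_invertible f) is left h then projT1 (cid h) else f.

Fact ncs_mulVf : {in ncs_unit, left_inverse 1 ncs_inv *%R}.
Proof.
move=> f; rewrite unfold_in => /asboolP uf; rewrite /ncs_inv.
by case: pselect => // h; case: cid => g [].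
Qed.

Fact ncs_mulfV : {in ncs_unit, right_inverse 1 ncs_inv *%R}.
Proof.
move=> f; rewrite unfold_in => /asboolP uf; rewrite /ncs_inv.
by case: pselect => // h; case: cid => g [].
Qed.

Fact ncs_unitP f g : g * f = 1 /\ f * g = 1 -> ncs_unit f.
Proof. by move=> fg; apply/asboolP; exists g. Qed.

Fact ncs_inv_out : {in [predC ncs_unit], ncs_inv =1 id}.
Proof.
move=> f; rewrite inE unfold_in => /asboolP nuf; rewrite /ncs_inv.
by case: pselect.
Qed.

HB.instance Definition _ := GRing.NzRing_hasMulInverse.Build (ncseries K)
  ncs_mulVf ncs_mulfV ncs_unitP ncs_inv_out.

(* Series with constant term 1 are invertible. *)

Fixpoint ncs_rinv_rec f (n : nat) : ncseries K := fun w =>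
  if w is l :: u then
    if n is m.+1 then - ncs_mul (ncs_shift l f) (ncs_rinv_rec f m) u else 0
  else 1.

Definition ncs_rinv f : ncseries K := fun w => ncs_rinv_rec f (size w) w.

Lemma ncs_rinv_recE f m n w : (size w <= m)%N -> (size w <= n)%N ->
  ncs_rinv_rec f m w = ncs_rinv_rec f n w.
Proof.
elim: m n w => [|m IHm] [|n] [|l w] //=; rewrite !ltnS => wm wn.
congr (- _); apply: eq_bigr => i _; congr (_ * _).
have swi : (size (drop i w) <= size w)%N by rewrite size_drop leq_subr.
by apply: IHm; apply: leq_trans swi _.
Qed.

Lemma ncs_mul_rinv f : f [::] = 1 -> f * ncs_rinv f = 1.
Proof.
move=> f1; apply/funext; case=> [|l w].
  by rewrite [LHS]ncs_mul_nil f1 mul1r.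
rewrite [LHS]ncs_mul_cons f1 mul1r.
suff -> : ncs_rinv f (l :: w) = - ncs_mul (ncs_shift l f) (ncs_rinv f) w.
  by rewrite addNr.
congr (- _); apply: eq_bigr => i _; congr (_ * _).
by apply: ncs_rinv_recE => //; rewrite size_drop leq_subr.
Qed.

Lemma ncs_unit_const1 f : f [::] = 1 -> f \is a GRing.unit.
Proof.
move=> f1; set g := ncs_rinv f; set h := ncs_rinv g.
have fg : f * g = 1 by apply: ncs_mul_rinv.
have gh : g * h = 1 by apply: ncs_mul_rinv.
apply/unitrP; exists g; split=> //.
have fh : f = h by rewrite -[LHS]mulr1 -gh mulrA fg mul1r.
by rewrite -[RHS]gh -fh.
Qed.

End NCSeriesRing.

Definition moment_series (R : realType) (mu : {scalar ncpoly R}) :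
    ncseries R[i] :=
  fun w => if w == [::] then 0 else mu (wpow (ncZ R) (ncZs R) w).

Lemma moment_series_unit (R : realType) (mu : {scalar ncpoly R}) :
  1 + moment_series mu \is a GRing.unit.
Proof. by apply: ncs_unit_const1; rewrite ncs_addE addr0. Qed.

Definition eta_series (R : realType) (mu : {scalar ncpoly R}) :
    ncseries R[i] :=
  moment_series mu * (1 + moment_series mu)^-1.

Definition eta_diagonal (R : realType) (mu : {scalar ncpoly R}) : Prop :=
  forall w : word, w != [::] ->
    ~ (exists m : nat, (0 < m)%N /\
         (w = word_exp [:: false; true] m \/
          w = word_exp [:: true; false] m)) ->
    eta_series mu w = 0.

(* A Borel measure is a function on Borel sets, whereas a measure of the library
   is a function on all sets, unconstrained outside the sigma-algebra. To have
   exactly one element for each Borel measure, the value there is fixed to 0. *)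
Definition borel_normalized (R : realType)
    (s : probability (measurableTypeR R) R) : Prop :=
  forall A : set (measurableTypeR R), ~ measurable A -> s A = 0%E.

(* Measures on [0, +oo[ are seen as measures on R concentrated on [0, +oo[. *)
Definition Pcplus (R : realType) : set (probability (measurableTypeR R) R) :=
  [set s | borel_normalized s /\
    exists K : set R, [/\ compact K, K `<=` `[0, +oo[ & s (~` K) = 0%E]].

Definition has_moments (R : realType) (mu : {scalar ncpoly R}) (p : ncpoly R)
    (s : probability (measurableTypeR R) R) : Prop :=
  forall n : nat, mu (p ^+ n) = (\int[s]_(t in `[0, +oo[) (t ^+ n))%:C%C.

(* Main.v *)
Require Import Defs.
From HB Require Import structures.
From mathcomp Require Import all_boot all_order all_algebra.
From mathcomp Require Import all_classical all_reals all_analysis.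
From mathcomp Require Import complex ring lra zify.
From mathcomp Require Import (canonicals, coercions) monalg.

Set Implicit Arguments.
Unset Strict Implicit.
Unset Printing Implicit Defensive.
Import Order.TTheory GRing.Theory Num.Theory.
Import numFieldNormedType.Exports.

Local Open Scope classical_set_scope.
Local Open Scope ring_scope.

(** Uniqueness is combinatorial: the coefficients of the eta-series on alternating
    words are determined by the moments of ZZ* and Z*Z, and M = eta (1 + M)
    recovers all moments from them.

    For existence let L be integration against a measure s on [0, B] (rescaled to
    [0, 1]). Replacing s by the discrete measure with weights
    'C(N, k) L(x^k (1 - x)^(N - k)) at the points B k / N changes the n-th moment
    by O(1 / N). For two discrete measures with N + 1 atoms an operator with the
    prescribed distributions acts on C (+) L1 (+) L1' (+) L2 (+) L2': it maps
    C (+) L1 to L1' by sqrt(t) and L2' to C (+) L2 by the adjoint, where C is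
    glued to each Li along the constant function. The vacuum state then kills all
    Boolean cumulants off the alternating words. The bounded sequences of such
    matrices form a C*-algebra, on which the limit of the vacuum states along an
    ultrafilter is a state; this gives the *-distribution for s1 and s2
    themselves.

    Conversely, for a in a C*-probability space, h = aa*/B and 1 - h are both of
    the form y* y, so L(p) = phi(p(h)) is nonnegative on x^k (1 - x)^j, and the
    same discretisation produces a measure: the ultrafilter limit of the discrete
    distribution functions, made right-continuous. Measures on [0, B] are
    determined by their moments since (1 - t^n)^m approximates indicator
    functions of intervals. *)

(** * Words, eta-series and uniqueness *)

(** The direct model would be multiplication by sqrt(t) on L^2 of s1 and of s2. Finitely many atoms
    turn it into a matrix, whose adjoint and Boolean cumulants are computed by block algebra; the
    price is a passage to the limit, for which only an operator bound independent of the number of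
    atoms has to be kept. An ultrafilter is taken because the limit state must be defined at once on
    every bounded sequence of matrices. Cumulants are polynomials in the moments, so their vanishing
    survives the limit. The primed copies separate the letters: away from the vacuum each summand is
    killed by one of the two operators, which forces the letters to alternate. The vacuum is the
    only link between the two sides, so s1 and s2 can be chosen independently. In the converse
    direction, positivity on x^k (1 - x)^j takes the place of the spectral theorem for aa*. It asks
    for a square root of 1 - h, which a contraction provides once B is large compared with the norm
    of aa*. *)

Section Words.
Variable A : nzRingType.
Implicit Types (x y : A) (u w : word).

Lemma wpow_nil x y : wpow x y [::] = 1.
Proof. by rewrite /wpow big_nil. Qed.

Lemma wpow_cons x y l w : wpow x y (l :: w) = (if l then y else x) * wpow x y w.
Proof. by rewrite /wpow big_cons. Qed.

Lemma wpow_cat x y u w : wpow x y (u ++ w) = wpow x y u * wpow x y w.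
Proof. by rewrite /wpow big_cat. Qed.

Lemma wpow_exp x y w m : wpow x y (word_exp w m) = wpow x y w ^+ m.
Proof.
elim: m => [|m IH]; first by rewrite wpow_nil expr0.
by rewrite /word_exp /= wpow_cat exprS -IH.
Qed.

Lemma wpow_altl x y m : wpow x y (word_exp [:: false; true] m) = (x * y) ^+ m.
Proof. by rewrite wpow_exp !wpow_cons wpow_nil mulr1. Qed.

Lemma wpow_altr x y m : wpow x y (word_exp [:: true; false] m) = (y * x) ^+ m.
Proof. by rewrite wpow_exp !wpow_cons wpow_nil mulr1. Qed.
End Words.

Definition alternating (w : word) := exists m : nat, (0 < m)%N /\
  (w = word_exp [:: false; true] m \/ w = word_exp [:: true; false] m).

Section BooleanCumulants.
Variable K : nzRingType.
Implicit Types (E M : ncseries K) (w : word).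

(* [E] is the eta-series of the moment series [M - 1]. *)
Definition eta_of E M := [/\ E [::] = 0, M [::] = 1 & M = 1 + E * M].

(** The full prefix is split off the convolution: as [M [::] = 1] it contributes [E w] alone. This
    is the Boolean moment-cumulant recursion. *)
Lemma eta_of_rec E M w : eta_of E M -> w != [::] ->
  M w = \sum_(i < size w) E (take i w) * M (drop i w) + E w.
Proof.
case=> E0 M0 eM w0; rewrite {1}eM ncs_addE.
have -> : (1 : ncseries K) w = 0 by rewrite /GRing.one /= /ncs_one (negPf w0).
rewrite add0r [LHS]/(ncs_mul _ _ _) /ncs_mul big_ord_recr /=.
by rewrite take_size drop_size M0 mulr1.
Qed.

(** By induction on the length, [eta_of_rec] determines each of [E w] and [M w] from the other and
    from shorter words; the moment is given on alternating words, the cumulant elsewhere. *)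
Lemma eta_of_unique E M E' M' :
  eta_of E M -> eta_of E' M' ->
  (forall w, w != [::] -> ~ alternating w -> E w = E' w) ->
  (forall w, alternating w -> M w = M' w) -> M = M'.
Proof.
move=> eM eM' hE hM; have [E0 M0 _] := eM; have [E0' M0' _] := eM'.
suff : forall n w, (size w <= n)%N -> E w = E' w /\ M w = M' w.
  by move=> h; apply/funext => w; have [] := h (size w) w (leqnn _).
elim=> [|n IH] w; first by rewrite leqn0 size_eq0 => /eqP ->; rewrite E0 E0' M0.
have [->|w0] := eqVneq w [::]; first by rewrite E0 E0' M0.
move=> sw.
have r : \sum_(i < size w) E (take i w) * M (drop i w)
       = \sum_(i < size w) E' (take i w) * M' (drop i w).
  (* The term of index 0 contains [M w] itself, but it vanishes because [E [::] = 0]; all others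
     involve shorter words only. *)
  apply: eq_bigr => -[[|i] /= iw] _; first by rewrite take0 E0 E0' !mul0r.
  have /IH[-> _] : (size (take i.+1 w) <= n)%N.
    by rewrite size_take iw -ltnS (leq_trans iw).
  have /IH[_ ->] : (size (drop i.+1 w) <= n)%N; last by [].
  rewrite size_drop leq_subLR; apply: leq_trans sw _.
  by rewrite -addn1 addnC leq_add2r.
have [aw|naw] := pselect (alternating w).
  split; last exact: hM.
  have := hM _ aw; rewrite (eta_of_rec eM w0) (eta_of_rec eM' w0) r.
  by move/addrI.
split; first exact: hE.
by rewrite (eta_of_rec eM w0) (eta_of_rec eM' w0) r hE.
Qed.

End BooleanCumulants.

(** Uniqueness of the functional is an equality of bundled maps, so the proofs packed with the
    functions have to be identified as well. *)
Lemma linear_ext (K : pzRingType) (U : lmodType K) (V : zmodType)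
    (s : K -> V -> V) (f g : {linear U -> V | s}) : f =1 g -> f = g.
Proof.
case: f g => f [[fD] [fZ]] [g [[gD] [gZ]]] /= /funext fg.
subst g; congr (GRing.Linear.Pack (GRing.Linear.Class _ _)).
  by congr (Algebra.isNmodMorphism.Axioms_ _ _ _); exact: Prop_irrelevance.
by congr (GRing.isScalable.Axioms_ _ _ _ _ _); exact: Prop_irrelevance.
Qed.

Section Functionals.
Variable R : realType.
Local Notation C := R[i].
Implicit Types mu : {scalar ncpoly R}.

Lemma eta_of_series mu :
  eta_of (eta_series mu) (1 + moment_series mu).
Proof.
have uM := moment_series_unit mu.
have M0 : (1 + moment_series mu) [::] = 1.
  by rewrite ncs_addE /moment_series eqxx addr0.
have eM : 1 + moment_series mu = 1 + eta_series mu * (1 + moment_series mu).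
  by rewrite /eta_series divrK.
(* [E [::] = 0] is the identity [M = 1 + E M] read at the empty word. *)
split=> //; have := congr1 (fun f : ncseries C => f [::]) eM.
rewrite M0 ncs_addE -[LHS]addr0 => /addrI.
by rewrite [RHS]ncs_mul_nil M0 mulr1.
Qed.

(** Words are the monomial basis of the free algebra: a functional is determined by its values on
    them and can be prescribed there. *)
Lemma wpow_monomial (w : word) :
  wpow (ncZ R) (ncZs R) w = monalg.mkmalgU (monalg.FMonom w) 1.
Proof.
elim: w => [|l w IH]; first 
  by rewrite wpow_nil -monalg.fmoneE.
have -> : monalg.FMonom (l :: w) = monalg.mmul (monalg.fmu l) (monalg.FMonom w).
  by apply/eqP; rewrite monalg.fmP monalg.fmM monalg.fmuE.
rewrite wpow_cons IH -[in RHS](mulr1 1).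
by case: l; rewrite monalg.malgM_def monalg.fgmulUU.
Qed.

Lemma scalar_ext mu mu' : (forall w, mu (wpow (ncZ R) (ncZs R) w)
    = mu' (wpow (ncZ R) (ncZs R) w)) -> mu = mu'.
Proof.
move=> h.
have lin (m : {scalar ncpoly R}) (c : C) (g : ncpoly R) : m (c *: g) = c * m g.
  exact: linearZ_LR.
apply: linear_ext => g; rewrite (monalg.monalgE g) !raddf_sum; apply: eq_bigr => k _.
have monomialE (m : {scalar ncpoly R}) :
      m (monalg.mkmalgU k (monalg.mcoeff k g))
      = monalg.mcoeff k g * m (wpow (ncZ R) (ncZs R) k).
    rewrite -lin; congr (m _); rewrite wpow_monomial monalg.fmK.
    by apply/monalg.malgP => j; rewrite monalg.mcoeffZ !monalg.mcoeffU mulrnAr mulr1.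
  by etransitivity; [exact: monomialE | rewrite h; symmetry; exact: monomialE].
Qed.

Lemma eta_diagonal_unique mu mu' : mu 1 = 1 -> mu' 1 = 1 ->
  eta_diagonal mu -> eta_diagonal mu' ->
  (forall m, mu ((ncZ R * ncZs R) ^+ m) = mu' ((ncZ R * ncZs R) ^+ m)) ->
  (forall m, mu ((ncZs R * ncZ R) ^+ m) = mu' ((ncZs R * ncZ R) ^+ m)) ->
  mu = mu'.
Proof.
move=> mu1 mu1' emu emu' hl hr.
have /(congr1 (fun f : ncseries C => f _)) eM :
    1 + moment_series mu = 1 + moment_series mu'.
  apply: eta_of_unique (eta_of_series mu) (eta_of_series mu') _ _.
    by move=> w w0 aw; rewrite emu // emu'.
  move=> w [m [m0 wm]].
  have hw : mu (wpow (ncZ R) (ncZs R) w) = mu' (wpow (ncZ R) (ncZs R) w).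
    case: wm => ->; [rewrite wpow_altl; exact: hl | rewrite wpow_altr; exact: hr].
  by rewrite !ncs_addE /moment_series hw.
apply: scalar_ext => w; have [->|w0] := eqVneq w [::]; first by rewrite wpow_nil mu1.
by have := eM w; rewrite !ncs_addE => /addrI; rewrite /moment_series (negPf w0).
Qed.

End Functionals.

(** * Boolean cumulants of a matrix *)

Section BooleanMatrix.
Variables (K : comNzRingType) (m : nat) (A B : 'M[K]_m.+1).
Implicit Types (r : 'rV[K]_m.+1) (w : word).

(** Vectors are rows and matrices act on the right, so a word acts starting with its first
    letter. *)
Definition vacuum : 'rV[K]_m.+1 := delta_mx 0 0.
Definition vacuum_perp : 'M[K]_m.+1 := 1 - delta_mx 0 0.

Definition vacuum_moment : ncseries K := fun w => (wpow A B w) 0 0.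

(** Total weight of the paths from [r] along [w] that reach the vacuum at the end of [w] and not
    before. *)
Definition reduced_moment r : ncseries K := fun w =>
  (r *m wpow (vacuum_perp * A) (vacuum_perp * B) w) 0 0.

(** Weight of the first returns of the vacuum to itself; the first letter therefore acts without a
    projection in front of it. *)
Definition boolean_cumulant : ncseries K := fun w =>
  if w is l :: u then reduced_moment (vacuum *m (if l then B else A)) u else 0.

Lemma vacuum_split r : r = r 0 0 *: vacuum + r *m vacuum_perp.
Proof.
rewrite /vacuum_perp mulmxBr mulmx1 addrCA; apply/rowP => j.
rewrite !mxE (bigD1 0) //= big1 => [|i i0]; last by rewrite !mxE (negPf i0) mulr0.
by rewrite !mxE eqxx addr0 subrr addr0.
Qed.

(** Paths are cut at their first visit to the vacuum, as in a renewal equation. The vector [r] is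
    general since each letter changes it in the induction. *)
Lemma moment_split r w :
  (r *m wpow A B w) 0 0 = ncs_mul (reduced_moment r) vacuum_moment w.
Proof.
elim: w r => [|l w IH] r.
  by rewrite ncs_mul_nil /reduced_moment /vacuum_moment !wpow_nil !mulmx1 mxE mulr1.
have -> : ncs_mul (reduced_moment r) vacuum_moment (l :: w)
   = r 0 0 * vacuum_moment (l :: w)
     + ncs_mul (reduced_moment (r *m vacuum_perp *m (if l then B else A)))
         vacuum_moment w.
  rewrite ncs_mul_cons; congr (_ * _ + ncs_mul _ _ w).
    by rewrite /reduced_moment wpow_nil mulmx1.
  apply/funext => u; rewrite /ncs_shift /reduced_moment wpow_cons.
  by case: l; rewrite -!mulmxE !mulmxA.
rewrite -IH {1}[r]vacuum_split mulmxDl mxE wpow_cons -mulmxE; congr (_ + _).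
  rewrite /vacuum_moment wpow_cons -scalemxAl mxE; congr (_ * _).
  by rewrite mxE (bigD1 0) //= big1 => [|i i0];
    rewrite !mxE ?(negPf i0) ?eqxx ?mul0r // mul1r addr0.
by rewrite !mulmxA.
Qed.

Lemma boolean_cumulantP : eta_of boolean_cumulant vacuum_moment.
Proof.
have m0 : vacuum_moment [::] = 1 by rewrite /vacuum_moment wpow_nil mxE.
split=> //; apply/funext => -[|l w].
  by rewrite ncs_addE [X in _ + X]ncs_mul_nil mul0r addr0 m0.
rewrite ncs_addE [X in _ + X]ncs_mul_cons mul0r !add0r -[RHS]moment_split.
rewrite -mulmxA mulmxE -wpow_cons /vacuum_moment mxE (bigD1 0) //= big1.
  by rewrite mxE eqxx mul1r addr0.
by move=> i i0; rewrite mxE (negPf i0) mul0r.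
Qed.

End BooleanMatrix.

Section Distribution.
Variable R : realType.
Local Notation C := R[i].

(** [mmap] receives an arbitrary function of the monomial, so the result is linear and in general
    not multiplicative. *)
Definition word_functional (f : word -> C) : ncpoly R -> C :=
  monalg.mmap idfun (fun w : monalg.fmonom bool => f w).

Fact word_functional_is_scalar f : scalar (word_functional f).
Proof.
move=> c g h; rewrite /word_functional raddfD /=; congr (_ + _).
rewrite (monalg.mmapEw (monalg.msuppZ_le _ _)) monalg.mmapE big_distrr /=.
by apply/eq_bigr=> k _; rewrite monalg.mcoeffZ mulrA.
Qed.

HB.instance Definition _ f := GRing.isLinear.Build C (ncpoly R) C *%R
  (word_functional f) (word_functional_is_scalar f).

Lemma word_functionalE f w :
  word_functional f (wpow (ncZ R) (ncZs R) w) = f w.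
Proof. by rewrite wpow_monomial /word_functional monalg.mmapU mul1r. Qed.

Lemma star_distribution_exists (P : cstar_prob_space R) (a : P) :
  exists mu, star_distribution a mu.
Proof.
exists (word_functional (fun w => cps_state P (wpow a (star a) w))); split.
  rewrite -(wpow_nil (ncZ R) (ncZs R)) [LHS]word_functionalE wpow_nil.
  exact: cps_state1.
by move=> w _; exact: word_functionalE.
Qed.

End Distribution.

(** * The C*-algebra of bounded families of matrices *)

Section RowNorm.
Variable C : numClosedFieldType.

Local Notation dot u v := (dotmx u%R v%R).
Local Notation "A ^H" := ((A ^t Num.conj)%sesqui) (at level 1).

Definition vnorm n (u : 'rV[C]_n) : C := sqrtC (dot u u).

Lemma sqr_vnorm n (u : 'rV[C]_n) : vnorm u ^+ 2 = dot u u.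
Proof. exact: sqrtCK. Qed.

Lemma vnorm_ge0 n (u : 'rV[C]_n) : 0 <= vnorm u.
Proof. exact: sqrt_dnorm_ge0. Qed.
Hint Resolve vnorm_ge0 : core.

Lemma vnorm0 n : vnorm (0 : 'rV[C]_n) = 0.
Proof. by apply/eqP; rewrite /vnorm sqrt_dnorm_eq0. Qed.

Lemma vnorm_eq0 n (u : 'rV[C]_n) : vnorm u = 0 -> u = 0.
Proof. by move/eqP; rewrite /vnorm sqrt_dnorm_eq0 => /eqP. Qed.

Lemma vnormZ n c (u : 'rV[C]_n) : vnorm (c *: u) = `|c| * vnorm u.
Proof.
by rewrite /vnorm dnormZ sqrtCM ?nnegrE ?exprn_ge0 ?dnorm_ge0 // sqrCK.
Qed.

Lemma vnormN n (u : 'rV[C]_n) : vnorm (- u) = vnorm u.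
Proof. by rewrite -scaleN1r vnormZ normrN1 mul1r. Qed.

Lemma vnormD n (u v : 'rV[C]_n) : vnorm (u + v) <= vnorm u + vnorm v.
Proof. by have [] := triangle_lerif (@dotmx C n) u v. Qed.

Lemma vnorm_CS n (u v : 'rV[C]_n) : `|dot u v| <= vnorm u * vnorm v.
Proof. by have [] := CauchySchwarz_sqrt (@dotmx C n) u v. Qed.

Lemma vnorm_sum n (I : Type) (r : seq I) (F : I -> 'rV[C]_n) :
  vnorm (\sum_(i <- r) F i) <= \sum_(i <- r) vnorm (F i).
Proof.
elim/big_ind2 : _ => // [|x1 y1 x2 y2 h1 h2]; first by rewrite vnorm0.
by apply: le_trans (vnormD _ _) _; apply: lerD.
Qed.

Lemma sqr_vnormE n (u : 'rV[C]_n) : vnorm u ^+ 2 = \sum_i `|u 0 i| ^+ 2.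
Proof.
rewrite sqr_vnorm dotmxE mxE; apply: eq_bigr => i _.
by rewrite !mxE normCK.
Qed.

Lemma coord_le_vnorm n (u : 'rV[C]_n) i : `|u 0 i| <= vnorm u.
Proof.
rewrite -ler_sqr ?nnegrE // sqr_vnormE (bigD1 i) //= lerDl.
by apply: sumr_ge0 => j _; rewrite exprn_ge0.
Qed.

Lemma vnorm_delta n (i : 'I_n) : vnorm (delta_mx 0 i : 'rV[C]_n) = 1.
Proof.
apply: (@pexpIrn _ 2); rewrite ?nnegrE // sqr_vnormE expr1n (bigD1 i) //=.
rewrite mxE !eqxx normr1 expr1n big1 ?addr0 // => j ji.
by rewrite mxE (negPf ji) andbF normr0 expr0n.
Qed.

Lemma dotmx_adj n (A : 'M[C]_n) u v : dot (u *m A) v = dot u (v *m A^H).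
Proof.
by rewrite !dotmxE -mulmxA trmx_mul map_mxM trmxCK.
Qed.

(** Bounds stand in for an operator norm: the norm of a family will be the infimum of its common
    bounds. *)
Definition opbound n (A : 'M[C]_n) (c : C) :=
  forall u, vnorm (u *m A) <= c * vnorm u.

Lemma opboundS n (A : 'M[C]_n) c d : opbound A c -> c <= d -> opbound A d.
Proof. by move=> Ac cd u; apply: le_trans (Ac u) _; rewrite ler_wpM2r. Qed.

Lemma opbound1 n : opbound (1%:M : 'M[C]_n) 1.
Proof. by move=> u; rewrite mulmx1 mul1r. Qed.

Lemma opboundD n (A B : 'M[C]_n) c d :
  opbound A c -> opbound B d -> opbound (A + B) (c + d).
Proof.
move=> Ac Bd u; rewrite mulmxDr mulrDl.
by apply: le_trans (vnormD _ _) _; apply: lerD.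
Qed.

Lemma opboundZ n (A : 'M[C]_n) c z : opbound A c -> opbound (z *: A) (`|z| * c).
Proof. by move=> Ac u; rewrite -scalemxAr vnormZ -mulrA ler_wpM2l. Qed.

Lemma opboundN n (A : 'M[C]_n) c : opbound A c -> opbound (- A) c.
Proof. by move=> Ac u; rewrite mulmxN vnormN. Qed.

Lemma opboundM n (A B : 'M[C]_n) c d :
  0 <= d -> opbound A c -> opbound B d -> opbound (A *m B) (c * d).
Proof.
move=> d0 Ac Bd u; rewrite mulmxA; apply: le_trans (Bd _) _.
by rewrite [c * d]mulrC -mulrA ler_wpM2l.
Qed.

(** Cauchy-Schwarz in |u A^H|^2 = <u A^H A, u> gives |u A^H|^2 <= c |u A^H| |u|, to be divided by |u
    A^H| when this is nonzero. *)
Lemma opbound_adj n (A : 'M[C]_n) c : 0 <= c -> opbound A c -> opbound A^H c.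
Proof.
move=> c0 Ac u; have [/eqP|u0] := eqVneq (vnorm (u *m A^H)) 0.
  by rewrite eq_le => /andP[h _]; apply: le_trans h _; rewrite mulr_ge0.
have p : 0 < vnorm (u *m A^H) by rewrite lt_def u0 vnorm_ge0.
rewrite -(ler_pM2r p) -expr2 sqr_vnorm.
rewrite -dotmx_adj -[leLHS]ger0_norm; last first.
  by rewrite dotmx_adj; exact: dnorm_ge0.
apply: le_trans (vnorm_CS _ _) _.
by rewrite -mulrA [_ * vnorm (_ *m _)]mulrC mulrA ler_wpM2r.
Qed.

(* The inequality |uA|^2 = <u A A*, u> <= |u A A*| |u| behind the C*-identity. *)
Lemma opbound_sqr n (A : 'M[C]_n) c : 0 <= c ->
  opbound (A *m A^H) (c ^+ 2) -> opbound A c.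
Proof.
move=> c0 Ac u; rewrite -ler_sqr ?nnegrE ?mulr_ge0 // sqr_vnorm dotmx_adj -mulmxA.
rewrite -[leLHS]ger0_norm; last by rewrite mulmxA -dotmx_adj; exact: dnorm_ge0.
apply: le_trans (vnorm_CS _ _) _.
by rewrite exprMn mulrC [vnorm u ^+ 2]expr2 mulrA ler_wpM2r.
Qed.

Lemma coord_le_opbound n (A : 'M[C]_n) c i j : opbound A c -> `|A i j| <= c.
Proof.
move=> /(_ (delta_mx 0 i)); rewrite vnorm_delta mulr1 -rowE.
by move=> h; apply: le_trans h; have := coord_le_vnorm (row i A) j; rewrite mxE.
Qed.

(** The crude factor n^2 is harmless: the bound serves for one fixed size at a time, to turn
    entrywise convergence into convergence of operators. *)
Lemma coords_opbound n (A : 'M[C]_n) c :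
  (forall i j, `|A i j| <= c) -> opbound A (n%:R * (n%:R * c)).
Proof.
move=> Ac u; have c0 (i : 'I_n) : 0 <= c by apply: le_trans (Ac i i).
have eA : u *m A = \sum_i \sum_j (u 0 i * A i j) *: (delta_mx 0 j).
  rewrite mulmx_sum_row; apply: eq_bigr => i _.
  rewrite [row i A]row_sum_delta scaler_sumr; apply: eq_bigr => j _.
  by rewrite mxE scalerA.
rewrite eA; apply: le_trans (vnorm_sum _ _) _.
have -> : n%:R * (n%:R * c) * vnorm u = \sum_(i < n) \sum_(j < n) c * vnorm u.
  by rewrite !sumr_const card_ord -mulrnA -[in RHS]mulr_natl natrM !mulrA.
apply: ler_sum => i _; apply: le_trans (vnorm_sum _ _) _.
apply: ler_sum => j _; rewrite vnormZ vnorm_delta mulr1 normrM mulrC.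
by apply: ler_pM => //; apply: coord_le_vnorm.
Qed.

End RowNorm.

(** The successor in the size provides the index 0 of the vacuum and makes 1 differ from 0. *)
Definition mxfam (K : nzRingType) (n : nat -> nat) : Type :=
  forall k, 'M[K]_((n k).+1).

HB.instance Definition _ K n := gen_eqMixin (@mxfam K n).
HB.instance Definition _ K n := gen_choiceMixin (@mxfam K n).

Section MxFam.
Variables (K : comNzRingType) (n : nat -> nat).
Implicit Types a b c : mxfam K n.

Lemma mxfamP a b : (forall k, a k = b k) -> a = b.
Proof. exact: functional_extensionality_dep. Qed.

Fact mxfam_addA : associative (fun a b => (fun k => a k + b k) : mxfam K n).
Proof. by move=> a b c; apply: mxfamP => k; rewrite addrA. Qed.
Fact mxfam_addC : commutative (fun a b => (fun k => a k + b k) : mxfam K n).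
Proof. by move=> a b; apply: mxfamP => k; rewrite addrC. Qed.
Fact mxfam_add0 :
  left_id (fun k => 0 : 'M[K]_((n k).+1))
    (fun a b => (fun k => a k + b k) : mxfam K n).
Proof. by move=> a; apply: mxfamP => k; rewrite add0r. Qed.
Fact mxfam_addN :
  left_inverse (fun k => 0 : 'M[K]_((n k).+1))
    (fun a => (fun k => - a k) : mxfam K n)
    (fun a b => (fun k => a k + b k) : mxfam K n).
Proof. by move=> a; apply: mxfamP => k; rewrite addNr. Qed.

HB.instance Definition _ := GRing.isZmodule.Build (mxfam K n)
  mxfam_addA mxfam_addC mxfam_add0 mxfam_addN.

Fact mxfam_mulA : associative (fun a b => (fun k => a k *m b k) : mxfam K n).
Proof. by move=> a b c; apply: mxfamP => k; rewrite mulmxA. Qed.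
Fact mxfam_mul1 :
  left_id (fun k => 1%:M : 'M[K]_((n k).+1))
    (fun a b => (fun k => a k *m b k) : mxfam K n).
Proof. by move=> a; apply: mxfamP => k; rewrite mul1mx. Qed.
Fact mxfam_mulr1 :
  right_id (fun k => 1%:M : 'M[K]_((n k).+1))
    (fun a b => (fun k => a k *m b k) : mxfam K n).
Proof. by move=> a; apply: mxfamP => k; rewrite mulmx1. Qed.
Fact mxfam_mulDl :
  left_distributive (fun a b => (fun k => a k *m b k) : mxfam K n) +%R.
Proof. by move=> a b c; apply: mxfamP => k; rewrite mulmxDl. Qed.
Fact mxfam_mulDr :
  right_distributive (fun a b => (fun k => a k *m b k) : mxfam K n) +%R.
Proof. by move=> a b c; apply: mxfamP => k; rewrite mulmxDr. Qed.
Fact mxfam_1neq0 : (fun k => 1%:M : 'M[K]_((n k).+1)) != 0 :> mxfam K n.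
Proof.
apply/eqP => /(congr1 (fun a : mxfam K n => a 0%N 0 0)) /eqP.
by rewrite !mxE eqxx oner_eq0.
Qed.

HB.instance Definition _ := GRing.Zmodule_isNzRing.Build (mxfam K n)
  mxfam_mulA mxfam_mul1 mxfam_mulr1 mxfam_mulDl mxfam_mulDr mxfam_1neq0.

Definition mxfam_scale (z : K) a : mxfam K n := fun k => z *: a k.

Fact mxfam_scaleA z y a :
  mxfam_scale z (mxfam_scale y a) = mxfam_scale (z * y) a.
Proof. by apply: mxfamP => k; rewrite /mxfam_scale scalerA. Qed.
Fact mxfam_scale1 : left_id 1 mxfam_scale.
Proof. by move=> a; apply: mxfamP => k; rewrite /mxfam_scale scale1r. Qed.
Fact mxfam_scaleDr : right_distributive mxfam_scale +%R.
Proof. by move=> z a b; apply: mxfamP => k; apply: scalerDr. Qed.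
Fact mxfam_scaleDl a : {morph mxfam_scale^~ a : z y / z + y}.
Proof. by move=> z y; apply: mxfamP => k; apply: scalerDl. Qed.

HB.instance Definition _ := GRing.Zmodule_isLmodule.Build K (mxfam K n)
  mxfam_scaleA mxfam_scale1 mxfam_scaleDr mxfam_scaleDl.

Fact mxfam_scaleAl (z : K) a b : z *: (a * b) = z *: a * b.
Proof. by apply: mxfamP => k; apply: scalemxAl. Qed.

HB.instance Definition _ :=
  GRing.Lmodule_isLalgebra.Build K (mxfam K n) mxfam_scaleAl.

Fact mxfam_scaleAr (z : K) a b : z *: (a * b) = a * (z *: b).
Proof. by apply: mxfamP => k; apply: scalemxAr. Qed.

HB.instance Definition _ :=
  GRing.Lalgebra_isAlgebra.Build K (mxfam K n) mxfam_scaleAr.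

End MxFam.

Section BoundedFam.
Variables (C : numClosedFieldType) (n : nat -> nat).

Definition fam_bounded (a : mxfam C n) (c : C) := forall k, opbound (a k) c.

Definition bounded_fam : {pred mxfam C n} :=
  fun a => `[< exists2 c, 0 <= c & fam_bounded a c >].

Lemma bounded_famP (a : mxfam C n) :
  reflect (exists2 c, 0 <= c & fam_bounded a c) (a \in bounded_fam).
Proof. exact: asboolP. Qed.

Fact bounded_fam_subalg : subalg_closed bounded_fam.
Proof.
split.
- by apply/bounded_famP; exists 1 => // k; apply: opbound1.
- move=> z a b /bounded_famP[c c0 ac] /bounded_famP[d d0 bd].
  apply/bounded_famP; exists (`|z| * c + d); first by rewrite addr_ge0 ?mulr_ge0.
  by move=> k; apply: opboundD; [exact: opboundZ|].
- move=> a b /bounded_famP[c c0 ac] /bounded_famP[d d0 bd].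
  apply/bounded_famP; exists (c * d); first by rewrite mulr_ge0.
  by move=> k; apply: opboundM.
Qed.

HB.instance Definition _ :=
  GRing.isSubalgClosed.Build C (mxfam C n) bounded_fam bounded_fam_subalg.

Record bfam := BFam { bfam_val :> mxfam C n; _ : bounded_fam bfam_val }.

HB.instance Definition _ := [isSub for bfam_val].
HB.instance Definition _ := [Choice of bfam by <:].
HB.instance Definition _ := [SubChoice_isSubAlgebra of bfam by <:].

End BoundedFam.

(** * The norm and the involution of bounded families *)

Section FamNorm.
Variables (R : realType) (n : nat -> nat).
Implicit Types (a b : bfam R[i] n) (c d : R).

Local Notation "A ^H" := ((A ^t Num.conj)%sesqui) (at level 1).

Lemma vnorm_real m (u : 'rV[R[i]]_m) : (complex.Re (vnorm u))%:C%C = vnorm u.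
Proof. by apply: RRe_real; apply: ger0_real; apply: vnorm_ge0. Qed.

Definition fam_bounds a : set R :=
  [set c | 0 <= c /\ fam_bounded a c%:C%C].

Definition fam_norm a : R := inf (fam_bounds a).

Lemma fam_bounds_nonempty a : fam_bounds a !=set0.
Proof.
have /bounded_famP[c c0 ac] : bfam_val a \in @bounded_fam R[i] n.
  by case: a => a aP.
exists (complex.Re c); split; first by rewrite -lecR RRe_real ?ger0_real.
by rewrite RRe_real ?ger0_real.
Qed.

Lemma fam_bounds_has_inf a : has_inf (fam_bounds a).
Proof.
split; first exact: fam_bounds_nonempty.
by exists 0 => c [].
Qed.

Lemma fam_norm_ge0 a : 0 <= fam_norm a.
Proof.
by apply: lb_le_inf; [exact: fam_bounds_nonempty | move=> c []].
Qed.

Lemma fam_norm_le a c : 0 <= c -> fam_bounded a c%:C%C -> fam_norm a <= c.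
Proof. by move=> c0 ac; apply: ge_inf => //; case: (fam_bounds_has_inf a). Qed.

(** The infimum is attained: for fixed [k] and nonzero [u], every common bound is at least the
    quotient |u a_k| / |u|, hence so is the infimum. *)
Lemma fam_norm_bounded a : fam_bounded a (fam_norm a)%:C%C.
Proof.
move=> k u; have [u0|u0] := eqVneq (vnorm u) 0.
  by rewrite (vnorm_eq0 u0) mul0mx vnorm0 mulr0.
have p : 0 < complex.Re (vnorm u).
  by rewrite -ltcR vnorm_real lt_def u0 vnorm_ge0.
rewrite -vnorm_real -[in leRHS]vnorm_real -rmorphM /= lecR -ler_pdivrMr //.
apply: lb_le_inf; first exact: fam_bounds_nonempty.
move=> c [c0 /(_ k u)]; rewrite -vnorm_real -[in leRHS]vnorm_real -rmorphM /=.
by rewrite lecR ler_pdivrMr.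
Qed.

Arguments fam_norm_bounded a k u : clear implicits.

Fact fam_norm_eq0 a : fam_norm a = 0 -> a = 0.
Proof.
move=> a0; apply: val_inj; apply: mxfamP => k; apply/matrixP => i j.
have := coord_le_opbound i j (fam_norm_bounded a k).
by rewrite a0 normr_le0 => /eqP ->; rewrite mxE.
Qed.

Fact fam_normD a b : fam_norm (a + b) <= fam_norm a + fam_norm b.
Proof.
apply: fam_norm_le; first by rewrite addr_ge0 ?fam_norm_ge0.
by move=> k; rewrite rmorphD; apply: opboundD; apply: fam_norm_bounded.
Qed.

Fact fam_normM a b : fam_norm (a * b) <= fam_norm a * fam_norm b.
Proof.
apply: fam_norm_le; first by rewrite mulr_ge0 ?fam_norm_ge0.
move=> k; rewrite rmorphM; apply: opboundM; rewrite ?lecR ?fam_norm_ge0 //;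
  exact: fam_norm_bounded.
Qed.

Lemma fam_normZ_le (z : R[i]) a :
  fam_norm (z *: a) <= complex.Re `|z| * fam_norm a.
Proof.
have rz : (complex.Re `|z|)%:C%C = `|z| by apply: RRe_real; apply: normr_real.
apply: fam_norm_le.
  rewrite mulr_ge0 ?fam_norm_ge0 // -lecR rz; exact: normr_ge0.
move=> k; rewrite rmorphM [X in X * _]rz; apply: opboundZ.
exact: fam_norm_bounded.
Qed.

(** The converse of [fam_normZ_le] is [fam_normZ_le] itself for z^-1 and the family z a. *)
Fact fam_normZ (z : R[i]) a :
  (fam_norm (z *: a))%:C%C = `|z| * (fam_norm a)%:C%C.
Proof.
have rz (y : R[i]) : (complex.Re `|y|)%:C%C = `|y|.
  by apply: RRe_real; apply: normr_real.
rewrite -[in RHS]rz -rmorphM; congr (_%:C)%C; apply/eqP.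
rewrite eq_le; apply/andP; split; first exact: fam_normZ_le.
set r := complex.Re _.
have rE : r%:C%C = `|z| by exact: rz.
have [z0|z0] := eqVneq z 0.
  suff -> : r = 0 by rewrite mul0r fam_norm_ge0.
  by apply: complexI; rewrite rE z0; apply: normr0.
have p : 0 < r by rewrite -ltcR rE normr_gt0.
rewrite -ler_pdivlMl //; have := fam_normZ_le z^-1 (z *: a).
rewrite scalerA mulVf // scale1r; congr (_ <= _ * _).
by apply: complexI; rewrite rz fmorphV /= rE normfV.
Qed.

Lemma bounded_star a : bounded_fam ((fun k => (bfam_val a k)^H) : mxfam R[i] n).
Proof.
apply/bounded_famP; exists (fam_norm a)%:C%C; first by rewrite lecR fam_norm_ge0.
move=> k; apply: opbound_adj; first by rewrite lecR fam_norm_ge0.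
exact: fam_norm_bounded.
Qed.

Definition fam_star a : bfam R[i] n := BFam (bounded_star a).

Fact fam_starK : involutive fam_star.
Proof.
by move=> a; apply: val_inj; apply: mxfamP => k /=; rewrite trmxCK.
Qed.

Fact fam_starD : {morph fam_star : a b / a + b}.
Proof.
move=> a b; apply: val_inj; apply: mxfamP => k /=.
by apply/matrixP => i j; rewrite !mxE rmorphD.
Qed.

Fact fam_starZ (z : R[i]) a : fam_star (z *: a) = z^* *: fam_star a.
Proof.
apply: val_inj; apply: mxfamP => k /=.
by apply/matrixP => i j; rewrite !mxE rmorphM.
Qed.

Fact fam_starM a b : fam_star (a * b) = fam_star b * fam_star a.
Proof.
apply: val_inj; apply: mxfamP => k /=.
by rewrite trmx_mul map_mxM.
Qed.

Lemma fam_norm_star a : fam_norm (fam_star a) <= fam_norm a.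
Proof.
apply: fam_norm_le; first exact: fam_norm_ge0.
move=> k; apply: opbound_adj; first by rewrite lecR fam_norm_ge0.
exact: fam_norm_bounded.
Qed.

Fact fam_norm_starM a : fam_norm (fam_star a * a) = fam_norm a ^+ 2.
Proof.
have le_star : fam_norm a <= fam_norm (fam_star a).
  by have := fam_norm_star (fam_star a); rewrite (fam_starK a).
apply: le_anti; apply/andP; split.
  apply: le_trans (fam_normM _ _) _; rewrite expr2.
  by apply: ler_wpM2r; [exact: fam_norm_ge0 | exact: fam_norm_star].
have N0 := fam_norm_ge0 (fam_star a * a).
(* With matrices acting on rows, [opbound_sqr] controls [A] by A A^H, so it is applied to [star a];
   [le_star] then brings the estimate back to [a]. *)
have le_sqrt : fam_norm (fam_star a) <= Num.sqrt (fam_norm (fam_star a * a)).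
  apply: fam_norm_le; first exact: sqrtr_ge0.
  move=> k; apply: opbound_sqr; first by rewrite lecR sqrtr_ge0.
  rewrite -rmorphXn /= (sqr_sqrtr N0) trmxCK.
  exact: (fam_norm_bounded (fam_star a * a) k).
rewrite -[leRHS](sqr_sqrtr N0).
apply: lerXn2r; [exact: fam_norm_ge0 | exact: sqrtr_ge0 |].
exact: le_trans le_star le_sqrt.
Qed.

End FamNorm.
Arguments fam_norm_bounded {R n} a k u.

(** * Completeness of the norm *)

Section Completeness.
Variable R : realType.

Lemma real_cauchy_lim (x : nat -> R) :
  (forall e : R, 0 < e -> exists N, forall m n,
     (N <= m)%N -> (N <= n)%N -> `|x m - x n| < e) ->
  exists l, forall e : R, 0 < e -> exists N, forall n,
     (N <= n)%N -> `|x n - l| < e.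
Proof.
move=> xC; have /R_complete /cvg_ex[l xl] : cauchy (x @ \oo).
  apply: cauchy_exP => e e0; have [N xN] := xC _ e0.
  exists (x N); exists N => // n /= Nn.
  by apply: xN.
exists l => e e0; move/cvgrPdist_lt : xl => /(_ _ e0)[N _ xN].
by exists N => n Nn; rewrite distrC; apply: xN.
Qed.

Lemma normc_geReIm (z : R[i]) :
  `|complex.Re z|%:C%C <= `|z| /\ `|complex.Im z|%:C%C <= `|z|.
Proof.
by rewrite normc_def !lecR; split; rewrite -sqrtr_sqr ler_wsqrtr // ?lerDl ?lerDr sqr_ge0.
Qed.

Lemma normc_lt (z : R[i]) (e : R) :
  `|complex.Re z| < e / 2 -> `|complex.Im z| < e / 2 -> `|z| < e%:C%C.
Proof.
move=> hr hi; rewrite [z]complexE; apply: le_lt_trans (ler_normD _ _) _.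
have ni : `|'i%C : R[i]| = 1 by rewrite normc_def /= expr0n expr1n add0r sqrtr1.
rewrite normrM ni mul1r !normc_def /= !expr0n /= !addr0 !sqrtr_sqr.
by rewrite -rmorphD ltcR [e]splitr ltrD.
Qed.

Lemma complex_cauchy_lim (x : nat -> R[i]) :
  (forall e : R, 0 < e -> exists N, forall m n,
     (N <= m)%N -> (N <= n)%N -> `|x m - x n| < e%:C%C) ->
  exists l, forall e : R, 0 < e -> exists N, forall n,
     (N <= n)%N -> `|x n - l| < e%:C%C.
Proof.
move=> xC.
have [a xa] : exists l, forall e : R, 0 < e -> exists N, forall n,
     (N <= n)%N -> `|complex.Re (x n) - l| < e.
  apply: real_cauchy_lim => e /xC[N xN]; exists N => m n Nm Nn.
  rewrite -raddfB -ltcR; have [h _] := normc_geReIm (x m - x n).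
  exact: le_lt_trans h (xN m n Nm Nn).
have [b xb] : exists l, forall e : R, 0 < e -> exists N, forall n,
     (N <= n)%N -> `|complex.Im (x n) - l| < e.
  apply: real_cauchy_lim => e /xC[N xN]; exists N => m n Nm Nn.
  rewrite -raddfB -ltcR; have [_ h] := normc_geReIm (x m - x n).
  exact: le_lt_trans h (xN m n Nm Nn).
exists (a +i* b)%C => e e0; have e20 : 0 < e / 2 by rewrite divr_gt0.
have [N1 h1] := xa _ e20; have [N2 h2] := xb _ e20.
exists (maxn N1 N2) => n; rewrite geq_max => /andP[n1 n2].
by apply: normc_lt; rewrite raddfB; [exact: h1 | exact: h2].
Qed.

Lemma opbound_cst_lim m (A : 'M[R[i]]_m) (c : R) :
  (forall d, 0 < d -> opbound A (c + d)%:C%C) -> opbound A c%:C%C.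
Proof.
move=> Ac u; rewrite -vnorm_real -[in leRHS]vnorm_real -rmorphM lecR.
have [u0|u0] := eqVneq (complex.Re (vnorm u)) 0.
  have v0 : vnorm u = 0 by rewrite -vnorm_real u0.
  by rewrite (vnorm_eq0 v0) mul0mx vnorm0 mulr0.
have p : 0 < complex.Re (vnorm u).
  by rewrite lt_def u0 -lecR vnorm_real; exact: vnorm_ge0.
rewrite -ler_pdivrMr //; apply/ler_addgt0Pr => d d0.
rewrite ler_pdivrMr //; have := Ac d d0 u.
by rewrite -vnorm_real -[in leRHS]vnorm_real -rmorphM lecR.
Qed.

Variable n : nat -> nat.

(** The limit is formed entry by entry, which gives convergence for each matrix separately; the
    Cauchy condition then makes it uniform in [k]. *)
Fact fam_norm_complete (u : nat -> bfam R[i] n) :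
  (forall e : R, 0 < e -> exists N : nat, forall p q : nat,
     (N <= p)%N -> (N <= q)%N -> fam_norm (u p - u q) < e) ->
  exists x : bfam R[i] n, forall e : R, 0 < e -> exists N : nat, forall p : nat,
     (N <= p)%N -> fam_norm (u p - x) < e.
Proof.
move=> uC.
have lim_entry k i j : exists l, forall e : R, 0 < e -> exists N, forall p,
    (N <= p)%N -> `|bfam_val (u p) k i j - l| < e%:C%C.
  apply: complex_cauchy_lim => e /uC[N uN]; exists N => p q Np Nq.
  have := coord_le_opbound i j (fam_norm_bounded (u p - u q) k).
  rewrite !mxE => h; apply: le_lt_trans h _.
  by rewrite ltcR; exact: uN.
pose x : mxfam R[i] n := fun k => \matrix_(i, j) projT1 (cid (lim_entry k i j)).
have xk k d : 0 < d -> exists N, forall p, (N <= p)%N ->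
    opbound (bfam_val (u p) k - x k) d%:C%C.
  move=> d0; pose m : R := (n k).+1%:R.
  have m0 : 0 < m by rewrite ltr0n.
  have d1 : 0 < m^-1 * (m^-1 * d) by rewrite !mulr_gt0 ?invr_gt0.
  have /choice[f fP] (ij : 'I_(n k).+1 * 'I_(n k).+1) : exists N, forall p,
      (N <= p)%N -> `|bfam_val (u p) k ij.1 ij.2 - x k ij.1 ij.2|
                    < (m^-1 * (m^-1 * d))%:C%C.
    by rewrite /x mxE; case: cid => l /= /(_ _ d1).
  exists (\max_ij f ij) => p pN.
  have -> : d%:C%C = (n k).+1%:R * ((n k).+1%:R * (m^-1 * (m^-1 * d))%:C%C).
    rewrite -(rmorph_nat (real_complex R)) -!rmorphM; congr (_%:C)%C.
    by rewrite -/m !mulVKf ?gt_eqF.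
  apply: coords_opbound => i j; rewrite !mxE; apply: ltW.
  have := fP (i, j) p; rewrite /= !mxE; apply.
  exact: leq_trans (leq_bigmax (i, j)) pN.
(* The index beyond which [u] is [d]-close to [x] depends on [k], but it only serves as an
   intermediate point: the resulting bound [e] does not depend on [k]. *)
have uxk e N : (forall p q : nat,
     (N <= p)%N -> (N <= q)%N -> fam_norm (u p - u q) < e) ->
    forall p, (N <= p)%N -> fam_bounded (fun k => bfam_val (u p) k - x k) e%:C%C.
  move=> uN p Np k; apply: opbound_cst_lim => d d0.
  have [M xM] := xk k _ d0.
  have Mq := leq_maxl M N; have Nq := leq_maxr M N.
  rewrite -[bfam_val _ k](subrK (bfam_val (u (maxn M N)) k)) -addrA.
  have -> : (e + d)%:C%C = e%:C%C + d%:C%C by exact: rmorphD.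
  apply: opboundD; last exact: xM.
  have := fam_norm_bounded (u p - u (maxn M N)) k.
  move/opboundS; apply; rewrite lecR ltW //; exact: uN.
have xB : bounded_fam x.
  have [N uN] := uC 1 ltr01; apply/bounded_famP.
  exists ((fam_norm (u N))%:C%C + 1%:C%C).
    by rewrite addr_ge0 // lecR ?fam_norm_ge0.
  move=> k; rewrite -[x k](subKr (bfam_val (u N) k)).
  apply: opboundD; first exact: fam_norm_bounded.
  by apply: opboundN; apply: (uxk 1 N uN).
exists (BFam xB) => e e0; have e20 : 0 < e / 2 by rewrite divr_gt0.
have [N uN] := uC _ e20; exists N => p Np.
(* Passing to the limit turns strict inequalities into weak ones, hence the start from [e / 2]. *)
apply: le_lt_trans (_ : e / 2 < e); last by rewrite ltr_pdivrMr // ltr_pMr // ltr1n.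
by apply: fam_norm_le; [exact: ltW | exact: (uxk _ _ uN)].
Qed.

HB.instance Definition _ := isCStarAlgebra.Build R (bfam R[i] n)
  (@fam_norm_eq0 R n) (@fam_normD R n) (@fam_normZ R n) (@fam_normM R n)
  fam_norm_complete (@fam_starK R n) (@fam_starD R n) (@fam_starZ R n)
  (@fam_starM R n) (@fam_norm_starM R n).

End Completeness.

(** * Limits along an ultrafilter *)

Definition nat_ultra : set_system nat :=
  projT1 (cid (ultraFilterLemma eventually_filter)).

#[global] Instance nat_ultra_ultra : UltraFilter nat_ultra.
Proof. by rewrite /nat_ultra; case: cid => /= G []. Qed.

#[global] Instance nat_ultra_proper : ProperFilter nat_ultra.
Proof. exact: ultra_proper. Qed.

Lemma nat_ultra_sub : nat_ultra --> \oo.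
Proof. by rewrite /nat_ultra; case: cid => /= G []. Qed.

Lemma fmap_ultra (T U : Type) (f : T -> U) (F : set_system T) :
  UltraFilter F -> UltraFilter (f @ F).
Proof.
move=> uF; have pF : ProperFilter F := ultra_proper.
split=> [|G pG FG]; first exact: fmap_proper_filter.
rewrite predeqE => A; split=> [GA|]; last exact: FG.
have [//|FAC] := in_ultra_setVsetC (f @^-1` A) uF.
have GAC : G (~` A) by apply: FG.
by have := @filter_not_empty _ G _; rewrite -(setICr A) => -[]; apply: filterI.
Qed.

Section Ulim.
Variable R : realType.
Implicit Types (x y : nat -> R) (z w : nat -> R[i]).

Definition ulim x : R := lim (x @ nat_ultra).

Lemma ulim_eq x l : x @ nat_ultra --> l -> ulim x = l.
Proof. exact: cvg_lim. Qed.

(** The image filter is again an ultrafilter and contains the compact segment [-b, b], so it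
    converges. *)
Lemma cvg_ulim x (b : R) : (forall k, `|x k| <= b) -> x @ nat_ultra --> ulim x.
Proof.
move=> xb.
have xi k : (x @^-1` `[- b, b]) k by rewrite /= in_itv /= -ler_norml.
have := @segment_compact R (- b) b; rewrite compact_ultra.
move=> /(_ (x @ nat_ultra) (fmap_ultra _ _) (@filterE _ nat_ultra _ _ xi)).
by case=> l [_ xl]; rewrite (ulim_eq xl).
Qed.

Definition ucvg z (l : R[i]) :=
  (fun k => complex.Re (z k)) @ nat_ultra --> complex.Re l /\
  (fun k => complex.Im (z k)) @ nat_ultra --> complex.Im l.

Definition culim z : R[i] :=
  (ulim (fun k => complex.Re (z k)) +i* ulim (fun k => complex.Im (z k)))%C.

Definition cbounded z := exists b : R, forall k, `|z k| <= b%:C%C.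

Lemma culim_eq z l : ucvg z l -> culim z = l.
Proof. by case: l => a b [] /ulim_eq /= za /ulim_eq /= zb; rewrite /culim za zb. Qed.

Lemma cvg_culim z : cbounded z -> ucvg z (culim z).
Proof.
case=> b zb; split; apply: (cvg_ulim (b := b)) => k; rewrite -lecR;
  have [hr hi] := normc_geReIm (z k).
  exact: le_trans hr (zb k).
exact: le_trans hi (zb k).
Qed.

Lemma ucvg_cst c : ucvg (fun=> c) c.
Proof. by split; apply: cvg_cst. Qed.

Lemma ucvgD z w l m : ucvg z l -> ucvg w m -> ucvg (fun k => z k + w k) (l + m).
Proof.
move=> [z1 z2] [w1 w2]; split; rewrite raddfD.
  by under eq_fun do rewrite raddfD; apply: cvgD.
by under eq_fun do rewrite raddfD; apply: cvgD.
Qed.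

Lemma ReM (a b : R[i]) : complex.Re (a * b) =
  complex.Re a * complex.Re b - complex.Im a * complex.Im b.
Proof. by case: a b => [? ?] []. Qed.

Lemma ImM (a b : R[i]) : complex.Im (a * b) =
  complex.Re a * complex.Im b + complex.Im a * complex.Re b.
Proof. by case: a b => [? ?] []. Qed.

Lemma ucvgM z w l m : ucvg z l -> ucvg w m -> ucvg (fun k => z k * w k) (l * m).
Proof.
move=> [z1 z2] [w1 w2]; split.
  rewrite ReM; under eq_fun do rewrite ReM.
  by apply: cvgB; apply: cvgM.
rewrite ImM; under eq_fun do rewrite ImM.
by apply: cvgD; apply: cvgM.
Qed.

Lemma ucvgN z l : ucvg z l -> ucvg (fun k => - z k) (- l).
Proof.
move=> /(ucvgM (ucvg_cst (-1))); rewrite mulN1r.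
by under eq_fun do rewrite mulN1r.
Qed.

Lemma ucvg_sum (I : Type) (r : seq I) (F : I -> nat -> R[i]) (l : I -> R[i]) :
  (forall i, ucvg (F i) (l i)) ->
  ucvg (fun k => \sum_(i <- r) F i k) (\sum_(i <- r) l i).
Proof.
move=> Fl; elim: r => [|i r IH].
  by rewrite big_nil; under eq_fun do rewrite big_nil; apply: ucvg_cst.
by rewrite big_cons; under eq_fun do rewrite big_cons; apply: ucvgD.
Qed.

Lemma ucvg_ge0 z l : ucvg z l -> (forall k, 0 <= z k) -> 0 <= l.
Proof.
move=> [zr zi] z0; rewrite lecE; apply/andP; split => /=.
  apply/eqP; rewrite -(ulim_eq zi); apply: ulim_eq.
  under eq_fun do rewrite (ger0_Im (z0 _)); exact: cvg_cst.
apply: (cvgr_to_ge zr); apply: filterE => k.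
by have := z0 k; rewrite lecE => /andP[].
Qed.

Lemma ucvg_real x (l : R) : x @ \oo --> l -> ucvg (fun k => (x k)%:C%C) l%:C%C.
Proof.
move=> xl; split => /=; last exact: cvg_cst.
apply: cvg_trans xl; apply: cvg_app; exact: nat_ultra_sub.
Qed.

Lemma ucvg_unique z l m : ucvg z l -> ucvg z m -> l = m.
Proof. by move=> /culim_eq <- /culim_eq. Qed.

End Ulim.

(** * The limit of the vacuum states *)

Section FamState.
Variables (R : realType) (n : nat -> nat).
Local Notation C := R[i].
Local Notation A := (bfam C n).
Local Notation "M ^H" := ((M ^t Num.conj)%sesqui) (at level 1).
Implicit Types a b : A.

Definition fam_state a : C := culim (fun k => bfam_val a k 0 0).

Lemma ucvg_fam_state a : ucvg (fun k => bfam_val a k 0 0) (fam_state a).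
Proof.
apply: cvg_culim; exists (fam_norm a) => k.
exact: coord_le_opbound (fam_norm_bounded a k).
Qed.

Fact fam_state_is_scalar : scalar fam_state.
Proof.
move=> c a b; apply: culim_eq.
have := ucvgD (ucvgM (ucvg_cst c) (ucvg_fam_state a)) (ucvg_fam_state b).
by congr ucvg; apply/funext => k; rewrite !mxE.
Qed.

HB.instance Definition _ :=
  GRing.isLinear.Build C A C *%R fam_state fam_state_is_scalar.

Fact fam_state_ge0 a : 0 <= fam_state (star a * a).
Proof.
apply: (ucvg_ge0 (ucvg_fam_state (star a * a))) => k.
rewrite mxE; apply: sumr_ge0 => j _.
by rewrite !mxE mulrC mul_conjC_ge0.
Qed.

Fact fam_state1 : fam_state 1 = 1.
Proof.
apply: culim_eq; have := ucvg_cst (1 : C).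
by congr ucvg; apply/funext => k; rewrite mxE eqxx.
Qed.

Definition fam_space : cstar_prob_space R :=
  CStarProbSpace fam_state_ge0 fam_state1.

Lemma wpow_fam a b w k :
  bfam_val (wpow a b w) k = wpow (bfam_val a k) (bfam_val b k) w.
Proof.
elim: w => [|l w IH]; first by rewrite !wpow_nil.
by rewrite !wpow_cons -IH; case: l.
Qed.

Variables (a : fam_space) (mu : {scalar ncpoly R}).
Hypothesis amu : star_distribution a mu.
Local Notation a_ k := (bfam_val (a : A) k).

Lemma ucvg_fam_moment w :
  ucvg (fun k => vacuum_moment (a_ k) (a_ k)^H w)
    (mu (wpow (ncZ R) (ncZs R) w)).
Proof.
have -> : mu (wpow (ncZ R) (ncZs R) w) = fam_state (wpow a (star a) w).
  case: amu => mu1; have [->|w0] := eqVneq w [::]; last exact.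
  by rewrite !wpow_nil mu1 fam_state1.
have := ucvg_fam_state (wpow a (star a) w).
by congr ucvg; apply/funext => k; rewrite wpow_fam.
Qed.

(** By [eta_of_rec] a cumulant is a polynomial in moments and in cumulants of shorter words, and
    limits along the ultrafilter respect sums and products. *)
Lemma ucvg_fam_eta w :
  ucvg (fun k => boolean_cumulant (a_ k) (a_ k)^H w) (eta_series mu w).
Proof.
have mM u : (1 + moment_series mu) u = mu (wpow (ncZ R) (ncZs R) u).
  rewrite ncs_addE /moment_series [X in X + _]/(ncs_one _ _) /ncs_one.
  have [->|u0] := eqVneq u [::]; last by rewrite add0r.
  by rewrite addr0 wpow_nil; case: amu.
suff : forall N u, (size u <= N)%N ->
    ucvg (fun k => boolean_cumulant (a_ k) (a_ k)^H u) (eta_series mu u).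
  by move=> h; exact: h (leqnn (size w)).
elim=> [|N IH] u; have [E0 _ _] := eta_of_series mu.
  by rewrite leqn0 size_eq0 => /eqP ->; rewrite E0; exact: ucvg_cst.
have [->|u0] := eqVneq u [::]; first by move=> _; rewrite E0; exact: ucvg_cst.
move=> su.
have -> : (fun k => boolean_cumulant (a_ k) (a_ k)^H u) =
   (fun k => vacuum_moment (a_ k) (a_ k)^H u +
      - (\sum_(i < size u) boolean_cumulant (a_ k) (a_ k)^H (take i u)
          * vacuum_moment (a_ k) (a_ k)^H (drop i u))).
  apply/funext => k; rewrite (eta_of_rec (boolean_cumulantP _ _) u0).
  by rewrite addrAC subrr add0r.
have -> : eta_series mu u = mu (wpow (ncZ R) (ncZs R) u) +
   - (\sum_(i < size u) eta_series mu (take i u)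
          * mu (wpow (ncZ R) (ncZs R) (drop i u))).
  rewrite -mM (eta_of_rec (eta_of_series mu) u0).
  under [X in - X]eq_bigr do rewrite -mM.
  by rewrite addrAC subrr add0r.
apply: ucvgD; first exact: ucvg_fam_moment.
apply: ucvgN; apply: ucvg_sum => i; apply: ucvgM; last exact: ucvg_fam_moment.
apply: IH; rewrite size_take ltn_ord -ltnS.
exact: leq_trans (ltn_ord i) su.
Qed.

End FamState.

(** * A matrix with prescribed vacuum moments *)

Section Model.
Local Open Scope sesquilinear_scope.
Variables (C : numClosedFieldType) (N : nat).
Variables (xi1 xi2 tau1 tau2 : 'rV[C]_N).
Local Notation "M ^H" := ((M ^t Num.conj)%sesqui) (at level 1).
Local Notation d := ((N + N) + (N + N))%N.

(** The complement of [xi] gets no coordinates of its own: a full copy of C^N is used, and this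
    projection is applied whenever the copy is entered or left. *)
Definition proj_compl (xi : 'rV[C]_N) : 'M[C]_N := 1%:M - xi^T *m xi.
Local Notation Q1 := (proj_compl xi1).
Local Notation Q2 := (proj_compl xi2).
Local Notation D1 := (diag_mx tau1).
Local Notation D2 := (diag_mx tau2).

(** [c] is the vacuum coordinate, [x] and [z] are the parts of L1 and L2 orthogonal to the
    constants, [y] and [t] belong to L1' and L2'. *)
Definition model_row (c : 'M[C]_1) (x y z t : 'rV[C]_N) : 'rV[C]_(1 + d) :=
  row_mx c (row_mx (row_mx x y) (row_mx z t)).

Definition model_op : 'M[C]_(1 + d) :=
  block_mx (0 : 'M[C]_1) (row_mx (row_mx 0 (xi1 *m D1)) 0)
    (col_mx 0 (col_mx 0 (D2 *m xi2^T)))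
    (block_mx (block_mx 0 (Q1 *m D1) 0 0) 0 0 (block_mx 0 0 (D2 *m Q2) 0)).

Definition model_adj : 'M[C]_(1 + d) :=
  block_mx (0 : 'M[C]_1) (row_mx 0 (row_mx 0 (xi2 *m D2)))
    (col_mx (col_mx 0 (D1 *m xi1^T)) 0)
    (block_mx (block_mx 0 0 (D1 *m Q1) 0) 0 0 (block_mx 0 (Q2 *m D2) 0 0)).

Lemma model_row_op c x y z t : model_row c x y z t *m model_op =
  model_row (t *m D2 *m xi2^T) 0 (c *m xi1 *m D1 + x *m Q1 *m D1)
    (t *m D2 *m Q2) 0.
Proof.
rewrite /model_row /model_op mul_row_block !mul_row_col.
rewrite !mul_mx_row !mul_row_block !mulmx0 !add0r !addr0 !add_row_mx.
rewrite ?addr0 ?add0r ?row_mx0 ?addr0 ?add0r ?add_row_mx ?addr0 ?add0r.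
by rewrite !mulmxA.
Qed.

Lemma model_row_adj c x y z t : model_row c x y z t *m model_adj =
  model_row (y *m D1 *m xi1^T) (y *m D1 *m Q1) 0 0
    (c *m xi2 *m D2 + z *m Q2 *m D2).
Proof.
rewrite /model_row /model_adj mul_row_block !mul_row_col.
rewrite !mul_mx_row !mul_row_block !mulmx0 !add0r !addr0 !add_row_mx.
rewrite ?addr0 ?add0r ?row_mx0 ?addr0 ?add0r ?add_row_mx ?addr0 ?add0r.
by rewrite !mulmxA.
Qed.

Lemma model_row00 c x y z t : model_row c x y z t 0 0 = c 0 0.
Proof.
transitivity (model_row c x y z t 0 (lshift d 0)); last exact: row_mxEl.
by congr (model_row c x y z t _ _); apply: val_inj.
Qed.

Lemma model_vacuum : vacuum C d = model_row 1%:M 0 0 0 0.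
Proof.
rewrite /model_row !row_mx0; apply/rowP => j; rewrite /vacuum [LHS]mxE eqxx /=.
rewrite [RHS]mxE; case: splitP => i ji; last by rewrite mxE -val_eqE /= ji.
by rewrite [RHS]mxE -!val_eqE /= ji (ord1 i).
Qed.

Lemma model_row_scale k : k *: model_row 1%:M 0 0 0 0 = model_row k%:M 0 0 0 0.
Proof. by rewrite /model_row !row_mx0 scale_row_mx scaler0 scale_scalar_mx mulr1. Qed.

Lemma model_row_add c x y z t :
  model_row c 0 0 0 0 + model_row 0 x y z t = model_row c x y z t.
Proof. by rewrite /model_row !add_row_mx !add0r addr0. Qed.

Lemma model_row_perp c x y z t :
  model_row c x y z t *m vacuum_perp C d = model_row 0 x y z t.
Proof.
apply: (addrI (c 0 0 *: vacuum C d)).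
have := vacuum_split (model_row c x y z t); rewrite model_row00 => <-.
have -> : c 0 0 *: vacuum C d = model_row c 0 0 0 0.
  rewrite model_vacuum [in RHS](mx11_scalar c); exact: model_row_scale.
by symmetry; exact: model_row_add.
Qed.

Hypothesis xi1_real : xi1 ^ Num.conj = xi1.
Hypothesis xi2_real : xi2 ^ Num.conj = xi2.
Hypothesis tau1_real : tau1 ^ Num.conj = tau1.
Hypothesis tau2_real : tau2 ^ Num.conj = tau2.

Lemma proj_compl_adj (xi : 'rV[C]_N) : xi ^ Num.conj = xi ->
  ((proj_compl xi)^T) ^ Num.conj = proj_compl xi.
Proof.
move=> xiR; rewrite /proj_compl linearB /= trmx1 trmx_mul trmxK.
by rewrite map_mxB map_mx1 map_mxM -map_trmx xiR.
Qed.

Lemma diag_real (tau : 'rV[C]_N) : tau ^ Num.conj = tau ->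
  (diag_mx tau) ^ Num.conj = diag_mx tau.
Proof. by move=> tauR; rewrite map_diag_mx tauR. Qed.

Lemma model_opH : model_op^H = model_adj.
Proof.
rewrite /model_op /model_adj.
do ?rewrite ?tr_block_mx ?tr_row_mx ?tr_col_mx ?map_block_mx ?map_row_mx ?map_col_mx.
rewrite !trmx_mul !trmxK !tr_diag_mx !map_mxM /= !trmx0 !map_mx0.
have e1 : (xi1^T) ^ Num.conj = xi1^T by rewrite -map_trmx xi1_real.
rewrite e1 xi2_real !diag_real //.
by rewrite !proj_compl_adj.
Qed.

Hypothesis xi1_unit : xi1 *m xi1^T = 1%:M.
Hypothesis xi2_unit : xi2 *m xi2^T = 1%:M.

Lemma proj_compl_unit (xi : 'rV[C]_N) : xi *m xi^T = 1%:M ->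
  xi *m proj_compl xi = 0 /\ proj_compl xi *m proj_compl xi = proj_compl xi.
Proof.
move=> xi1'; have xiQ : xi *m proj_compl xi = 0.
  by rewrite /proj_compl mulmxBr mulmx1 mulmxA xi1' mul1mx subrr.
by split=> //; rewrite {1}/proj_compl mulmxBl mul1mx -mulmxA xiQ mulmx0 subr0.
Qed.

Lemma proj_complD (xi v : 'rV[C]_N) : xi *m xi^T = 1%:M ->
  v *m xi^T *m xi + v *m proj_compl xi *m proj_compl xi = v.
Proof.
move=> /proj_compl_unit[_ QQ]; rewrite -[X in _ + X]mulmxA QQ -mulmxA -mulmxDr.
by rewrite /proj_compl addrC subrK mulmx1.
Qed.

(** The copy of L1 in the model, with the component along the constant function [xi1] in the vacuum
    coordinate. On it [model_op] followed by [model_adj] is multiplication by the squares of the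
    entries of [tau1]. *)
Definition model_rep1 v := model_row (v *m xi1^T) (v *m Q1) 0 0 0.
Definition model_rep2 v := model_row (v *m xi2^T) 0 0 (v *m Q2) 0.

Lemma model_rep1_step v :
  model_rep1 v *m model_op *m model_adj = model_rep1 (v *m D1 *m D1).
Proof.
by rewrite model_row_op !mul0mx -mulmxDl proj_complD // model_row_adj !mul0mx addr0.
Qed.

Lemma model_rep2_step v :
  model_rep2 v *m model_adj *m model_op = model_rep2 (v *m D2 *m D2).
Proof.
by rewrite model_row_adj !mul0mx -mulmxDl proj_complD // model_row_op !mul0mx addr0.
Qed.

Lemma model_vacuum1 : vacuum C d = model_rep1 xi1.
Proof.
by rewrite model_vacuum /model_rep1 xi1_unit; have [-> _] := proj_compl_unit xi1_unit.
Qed.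

Lemma model_vacuum2 : vacuum C d = model_rep2 xi2.
Proof.
by rewrite model_vacuum /model_rep2 xi2_unit; have [-> _] := proj_compl_unit xi2_unit.
Qed.

Lemma diag_sqr_sum (v tau xi : 'rV[C]_N) m :
  \sum_j (v *m diag_mx tau *m diag_mx tau) 0 j * xi 0 j * (tau 0 j ^+ 2) ^+ m
  = \sum_j v 0 j * xi 0 j * (tau 0 j ^+ 2) ^+ m.+1.
Proof.
apply: eq_bigr => j _; rewrite !mul_mx_diag !mxE [_ ^+ m.+1]exprS mulrA.
by congr (_ * _); rewrite expr2 -!mulrA; congr (_ * _); rewrite mulrCA mulrA mulrC.
Qed.

Lemma model_moment1 m :
  vacuum_moment model_op model_adj (word_exp [:: false; true] m)
  = \sum_j xi1 0 j ^+ 2 * (tau1 0 j ^+ 2) ^+ m.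
Proof.
rewrite /vacuum_moment wpow_altl.
have h v : (model_rep1 v *m (model_op * model_adj) ^+ m) 0 0
    = \sum_j v 0 j * xi1 0 j * (tau1 0 j ^+ 2) ^+ m.
  elim: m v => [|m IH] v.
    rewrite expr0 mulmx1 model_row00 mxE; apply: eq_bigr => j _.
    by rewrite mxE expr0 mulr1.
  by rewrite exprS -mulmxE mulmxA mulmxA model_rep1_step IH diag_sqr_sum.
have := h xi1; rewrite -model_vacuum1 -rowE mxE => ->.
by apply: eq_bigr => j _; rewrite expr2.
Qed.

Lemma model_moment2 m :
  vacuum_moment model_op model_adj (word_exp [:: true; false] m)
  = \sum_j xi2 0 j ^+ 2 * (tau2 0 j ^+ 2) ^+ m.
Proof.
rewrite /vacuum_moment wpow_altr.
have h v : (model_rep2 v *m (model_adj * model_op) ^+ m) 0 0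
    = \sum_j v 0 j * xi2 0 j * (tau2 0 j ^+ 2) ^+ m.
  elim: m v => [|m IH] v.
    rewrite expr0 mulmx1 model_row00 mxE; apply: eq_bigr => j _.
    by rewrite mxE expr0 mulr1.
  by rewrite exprS -mulmxE mulmxA mulmxA model_rep2_step IH diag_sqr_sum.
have := h xi2; rewrite -model_vacuum2 -rowE mxE => ->.
by apply: eq_bigr => j _; rewrite expr2.
Qed.

Local Notation reduced r := (reduced_moment model_op model_adj r).

Lemma model_row0 : model_row 0 0 0 0 0 = 0.
Proof. by rewrite /model_row !row_mx0. Qed.

Lemma reduced_cons r l u : reduced r (l :: u)
  = reduced (r *m vacuum_perp C d *m (if l then model_adj else model_op)) u.
Proof.
rewrite /reduced_moment wpow_cons.
by case: l; rewrite -!mulmxE !mulmxA.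
Qed.

Lemma reduced0 u : reduced 0 u = 0.
Proof. by rewrite /reduced_moment mul0mx mxE. Qed.

(** An automaton with two states: from [x] only the letter 1 survives and leads to [y], from [y]
    only the letter * survives and leads back. The vacuum coordinate is erased before the next
    letter, so a path cannot cross to the other side. *)
Lemma reduced_side1 u :
  (forall c x, reduced (model_row c x 0 0 0) u = 0 \/
     exists m, u = word_exp [:: false; true] m) /\
  (forall y, reduced (model_row 0 0 y 0 0) u = 0 \/
     exists m, u = true :: word_exp [:: false; true] m).
Proof.
elim: u => [|l u [IHx IHy]].
  split=> [c x|y]; first by right; exists 0%N.
  by left; rewrite /reduced_moment wpow_nil mulmx1 model_row00 mxE.
split=> [c x|y]; rewrite reduced_cons model_row_perp; case: l.
- by left; rewrite model_row_adj !mul0mx addr0 model_row0 reduced0.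
- rewrite model_row_op !mul0mx add0r.
  have [|[m um]] := IHy (x *m Q1 *m D1); first by left.
  by right; exists m.+1; rewrite um.
- rewrite model_row_adj !mul0mx addr0.
  have [|[m um]] := IHx (y *m D1 *m xi1^T) (y *m D1 *m Q1); first by left.
  by right; exists m; rewrite um.
- by left; rewrite model_row_op !mul0mx addr0 model_row0 reduced0.
Qed.

Lemma reduced_side2 u :
  (forall c z, reduced (model_row c 0 0 z 0) u = 0 \/
     exists m, u = word_exp [:: true; false] m) /\
  (forall t, reduced (model_row 0 0 0 0 t) u = 0 \/
     exists m, u = false :: word_exp [:: true; false] m).
Proof.
elim: u => [|l u [IHz IHt]].
  split=> [c z|t]; first by right; exists 0%N.
  by left; rewrite /reduced_moment wpow_nil mulmx1 model_row00 mxE.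
split=> [c z|t]; rewrite reduced_cons model_row_perp; case: l.
- rewrite model_row_adj !mul0mx add0r.
  have [|[m um]] := IHt (z *m Q2 *m D2); first by left.
  by right; exists m.+1; rewrite um.
- by left; rewrite model_row_op !mul0mx addr0 model_row0 reduced0.
- by left; rewrite model_row_adj !mul0mx addr0 model_row0 reduced0.
- rewrite model_row_op !mul0mx addr0.
  have [|[m um]] := IHz (t *m D2 *m xi2^T) (t *m D2 *m Q2); first by left.
  by right; exists m; rewrite um.
Qed.

(** The first letter chooses the side: 1 leads from the vacuum to L1', and * leads to L2'. *)
Lemma model_diagonal w : ~ alternating w -> boolean_cumulant model_op model_adj w = 0.
Proof.
case: w => [//|l u] naw; rewrite /boolean_cumulant model_vacuum; case: l naw => naw.
  rewrite model_row_adj !mul0mx addr0.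
  have [_ /(_ (1%:M *m xi2 *m D2))[//|[m um]]] := reduced_side2 u.
  by case: naw; exists m.+1; split=> //; right; rewrite um.
rewrite model_row_op !mul0mx addr0.
have [_ /(_ (1%:M *m xi1 *m D1))[//|[m um]]] := reduced_side1 u.
by case: naw; exists m.+1; split=> //; left; rewrite um.
Qed.

End Model.

(** * A bound for the model independent of its size *)

Section ModelBound.
Variable C : numClosedFieldType.
Implicit Types N p q : nat.

Lemma vnorm_row_mx p q (u : 'rV[C]_p) (v : 'rV[C]_q) :
  vnorm (row_mx u v) ^+ 2 = vnorm u ^+ 2 + vnorm v ^+ 2.
Proof.
rewrite !sqr_vnormE big_split_ord /=; congr (_ + _); apply: eq_bigr => i _.
  by rewrite row_mxEl.
by rewrite row_mxEr.
Qed.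

Lemma vnorm_row_mx_le p q (u : 'rV[C]_p) (v : 'rV[C]_q) :
  vnorm (row_mx u v) <= vnorm u + vnorm v.
Proof.
rewrite -ler_sqr ?nnegrE ?addr_ge0 ?vnorm_ge0 // vnorm_row_mx sqrrD.
by rewrite addrAC lerDl mulrn_wge0 // mulr_ge0 ?vnorm_ge0.
Qed.

Lemma vnorm_row_mxl p q (u : 'rV[C]_p) (v : 'rV[C]_q) :
  vnorm u <= vnorm (row_mx u v).
Proof.
by rewrite -ler_sqr ?nnegrE ?vnorm_ge0 // vnorm_row_mx lerDl exprn_ge0 ?vnorm_ge0.
Qed.

Lemma vnorm_row_mxr p q (u : 'rV[C]_p) (v : 'rV[C]_q) :
  vnorm v <= vnorm (row_mx u v).
Proof.
by rewrite -ler_sqr ?nnegrE ?vnorm_ge0 // vnorm_row_mx lerDr exprn_ge0 ?vnorm_ge0.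
Qed.

Variables (N : nat) (b : C).

Lemma vnorm_diag (v tau : 'rV[C]_N) : 0 <= b -> (forall j, `|tau 0 j| <= b) ->
  vnorm (v *m diag_mx tau) <= b * vnorm v.
Proof.
move=> b0 taub; rewrite -ler_sqr ?nnegrE ?mulr_ge0 ?vnorm_ge0 // exprMn.
rewrite !sqr_vnormE mulr_sumr; apply: ler_sum => j _.
rewrite mul_mx_diag mxE normrM exprMn mulrC ler_wpM2r ?exprn_ge0 //.
by rewrite ler_sqr ?nnegrE.
Qed.

Variable xi : 'rV[C]_N.
Hypothesis xi_real : (xi ^ Num.conj)%sesqui = xi.
Hypothesis xi_unit : xi *m xi^T = 1%:M.

Lemma vnorm_unit : vnorm xi = 1.
Proof.
apply: (@pexpIrn _ 2); rewrite ?nnegrE ?vnorm_ge0 // expr1n sqr_vnorm dotmxE.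
by rewrite -map_trmx xi_real xi_unit mxE.
Qed.

Lemma vnorm_coef (v : 'rV[C]_N) : vnorm (v *m xi^T) <= vnorm v.
Proof.
have -> : vnorm (v *m xi^T) = `|dotmx v xi|.
  apply: (@pexpIrn _ 2); rewrite ?nnegrE ?vnorm_ge0 // sqr_vnormE.
  by rewrite big_ord1 dotmxE -map_trmx xi_real.
by apply: le_trans (vnorm_CS _ _) _; rewrite vnorm_unit mulr1.
Qed.

Lemma vnorm_line (c : 'M[C]_1) : vnorm (c *m xi) <= vnorm c.
Proof.
rewrite [c in c *m _]mx11_scalar mul_scalar_mx vnormZ vnorm_unit mulr1.
exact: coord_le_vnorm.
Qed.

Lemma vnorm_proj_compl (v : 'rV[C]_N) : vnorm (v *m proj_compl xi) <= 2 * vnorm v.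
Proof.
rewrite mulmxBr mulmx1 mulr2n mulrDl mul1r mulmxA.
apply: le_trans (vnormD _ _) _; rewrite vnormN lerD2l.
exact: le_trans (vnorm_line _) (vnorm_coef _).
Qed.

End ModelBound.

(** The constant is 1 + 1 + 2 + 2, one summand for each nonzero block of [model_row_op], with 2 for
    a block containing a projection. What matters is that it is free of [N]. *)
Lemma opbound_model_op (C : numClosedFieldType) N (xi1 xi2 tau1 tau2 : 'rV[C]_N) b :
  (xi1 ^ Num.conj)%sesqui = xi1 -> (xi2 ^ Num.conj)%sesqui = xi2 ->
  xi1 *m xi1^T = 1%:M -> xi2 *m xi2^T = 1%:M ->
  0 <= b -> (forall j, `|tau1 0 j| <= b) -> (forall j, `|tau2 0 j| <= b) ->
  opbound (model_op xi1 xi2 tau1 tau2) (6 * b).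
Proof.
move=> r1 r2 u1 u2 b0 b1 b2 u.
have [c [x [y [z [t ->]]]]] : exists c x y z t, u = model_row c x y z t.
  exists (lsubmx (u : 'rV_(1 + _))), (lsubmx (lsubmx (rsubmx (u : 'rV_(1 + _))))),
    (rsubmx (lsubmx (rsubmx (u : 'rV_(1 + _))))), (lsubmx (rsubmx (rsubmx (u : 'rV_(1 + _))))),
    (rsubmx (rsubmx (rsubmx (u : 'rV_(1 + _))))).
  by rewrite /model_row !hsubmxK.
rewrite model_row_op; set v := model_row c x y z t.
have cv : vnorm c <= vnorm v := vnorm_row_mxl _ _.
have dv : vnorm (row_mx (row_mx x y) (row_mx z t)) <= vnorm v := vnorm_row_mxr _ _.
have xv : vnorm x <= vnorm v.
  exact: le_trans (vnorm_row_mxl _ _) (le_trans (vnorm_row_mxl _ _) dv).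
have tv : vnorm t <= vnorm v.
  exact: le_trans (vnorm_row_mxr _ _) (le_trans (vnorm_row_mxr _ _) dv).
have tD : vnorm (t *m diag_mx tau2) <= b * vnorm v.
  by apply: le_trans (vnorm_diag _ b0 b2) _; rewrite ler_wpM2l.
have h1 : vnorm (t *m diag_mx tau2 *m xi2^T) <= b * vnorm v.
  exact: le_trans (vnorm_coef r2 u2 _) tD.
have h2 : vnorm (t *m diag_mx tau2 *m proj_compl xi2) <= 2 * (b * vnorm v).
  apply: le_trans (vnorm_proj_compl r2 u2 _) _.
  by rewrite ler_wpM2l.
have h3 : vnorm (c *m xi1 *m diag_mx tau1) <= b * vnorm v.
  apply: le_trans (vnorm_diag _ b0 b1) _; rewrite ler_wpM2l //.
  exact: le_trans (vnorm_line r1 u1 _) cv.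
have h4 : vnorm (x *m proj_compl xi1 *m diag_mx tau1) <= b * (2 * vnorm v).
  apply: le_trans (vnorm_diag _ b0 b1) _; rewrite ler_wpM2l //.
  by apply: le_trans (vnorm_proj_compl r1 u1 _) _; rewrite ler_wpM2l.
apply: le_trans (vnorm_row_mx_le _ _) _.
have -> : 6 * b * vnorm v = b * vnorm v + (b * vnorm v + b * (2 * vnorm v)
    + 2 * (b * vnorm v)).
  by ring.
apply: lerD h1 _; apply: le_trans (vnorm_row_mx_le _ _) _; apply: lerD.
  apply: le_trans (vnorm_row_mx_le _ _) _; rewrite vnorm0 add0r.
  by apply: le_trans (vnormD _ _) _; apply: lerD.
by apply: le_trans (vnorm_row_mx_le _ _) _; rewrite vnorm0 addr0.
Qed.

(** * Bernstein discretisation of a positive functional *)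

Section Bernstein.

(** Factorial moments of the binomial distribution: falling factorials, unlike powers, are
    reproduced exactly by Bernstein sums when x + y = 1. *)
Lemma sum_binomial_ffact (K : comNzRingType) (x y : K) N n :
  \sum_(k < N.+1) (x ^+ k * y ^+ (N - k)) *+ ('C(N, k) * k ^_ n)
  = (x ^+ n * (x + y) ^+ (N - n)) *+ N ^_ n.
Proof.
elim: n N => [|n IH] N.
  rewrite subn0 expr0 mul1r ffactn0 mulr1n addrC exprDn; apply: eq_bigr => k _.
  by rewrite ffactn0 muln1 mulrC.
rewrite big_ord_recl ffact0n muln0 mulr0n add0r.
case: N => [|N]; first by rewrite big_ord0 ffact0n mulr0n.
transitivity (\sum_(k < N.+1)
    (x * ((x ^+ k * y ^+ (N - k)) *+ ('C(N, k) * k ^_ n))) *+ N.+1).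
  apply: eq_bigr => k _; rewrite lift0 subSS ffactSS exprS -mulrA mulnA.
  rewrite [('C(_, _) * _)%N]mulnC -mul_bin_diag -mulnA mulnC mulrnA.
  by rewrite mulrnAr.
by rewrite sumrMnl -mulr_sumr IH ffactSS subSS exprS -mulrA mulrnAr mulnC mulrnA.
Qed.

(** This says that powers exceed falling factorials by at most n^2 N^(n - 1), multiplied by [N] to
    stay in the naturals. The induction uses k k^_n = k^_(n+1) + n k^_n and n^2 + n <= (n + 1)^2. *)
Lemma pow_le_ffact N n k : (k <= N)%N ->
  (k ^ n * N <= k ^_ n * N + n ^ 2 * N ^ n)%N.
Proof.
move=> kN; elim: n => [|n IH]; first by rewrite !expn0 ffactn0 leq_addr.
have h1 : (k ^ n <= N ^ n)%N by case: n {IH} => // n; rewrite leq_exp2r.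
have h2 : (k ^_ n.+1 + n * k ^_ n >= k * k ^_ n)%N.
  by rewrite ffactnSr mulnBr [(_ * n)%N]mulnC; lia.
have h3 : (k ^_ n <= k ^ n)%N.
  elim: n {IH h1 h2} => // n h; by rewrite ffactnSr expnSr leq_mul // leq_subr.
have hA := leq_mul (leqnn k) IH.
rewrite !expnS ?expn0 ?expn1 ?muln1 in hA *.
have hB : (k * k ^_ n * N <= (k ^_ n.+1 + n * k ^_ n) * N)%N by rewrite leq_mul2r h2 orbT.
have hC : (n * k ^_ n * N <= n * N ^ n * N)%N.
  by rewrite leq_mul2r leq_mul2l (leq_trans h3 h1) !orbT.
have hD : (k * (n * n * N ^ n) <= N * (n * n * N ^ n))%N by rewrite leq_mul2r kN orbT.
lia.
Qed.

Section PositiveFunctional.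
Variable R : realType.
Variable L : {scalar {poly R}}.

(* [L] behaves as integration against a probability measure on [0, 1]. *)
Definition hausdorff_positive :=
  L 1 = 1 /\ forall k j, 0 <= L ('X ^+ k * (1 - 'X) ^+ j).

Definition bernstein_weight N k : R :=
  L ('X ^+ k * (1 - 'X) ^+ (N - k)) *+ 'C(N, k).

Hypothesis L_pos : hausdorff_positive.

Lemma bernstein_weight_ge0 N k : 0 <= bernstein_weight N k.
Proof. by rewrite mulrn_wge0 //; case: L_pos. Qed.

Lemma sum_bernstein_ffact N n :
  \sum_(k < N.+1) bernstein_weight N k *+ k ^_ n = L 'X^n *+ N ^_ n.
Proof.
have /(congr1 L) := @sum_binomial_ffact {poly R} 'X (1 - 'X) N n.
have -> : 'X + (1 - 'X) = 1 :> {poly R} by rewrite addrC subrK.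
rewrite expr1n mulr1 raddf_sum raddfMn /= => <-.
by apply: eq_bigr => k _; rewrite raddfMn /= mulrnA.
Qed.

Lemma sum_bernstein_weight N : \sum_(k < N.+1) bernstein_weight N k = 1.
Proof.
have := sum_bernstein_ffact N 0; rewrite ffactn0 expr0 mulr1n.
by case: L_pos => -> _ <-; apply: eq_bigr => k _; rewrite ffactn0.
Qed.

(** With D = n^2 N^(n - 1), both the unnormalised sum [S] and L(x^n) N^n lie between L(x^n) N^_n and
    that number plus [D]; division by N^n leaves n^2 / N. *)
Lemma bernstein_moment_error N n : (0 < N)%N ->
  `|\sum_(k < N.+1) bernstein_weight N k * (k%:R / N%:R) ^+ n - L 'X^n|
  <= (n ^ 2)%:R / N%:R.
Proof.
move=> N0; have NR : 0 < N%:R :> R by rewrite ltr0n.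
have w0 := bernstein_weight_ge0 N.
pose S := \sum_(k < N.+1) bernstein_weight N k * (k%:R ^+ n).
have LX0 : 0 <= L 'X^n.
  by case: L_pos => _ /(_ n 0%N); rewrite expr0 mulr1.
have LX1 : L 'X^n <= 1.
  (* L(x^n) <= 1 is read off the exact identity with N = n, where only the term k = n has a nonzero
     falling factorial. *)
  have f0 : (0 < n ^_ n)%N by rewrite ffact_gt0.
  rewrite -(ler_pMn2r f0) -sum_bernstein_ffact -(sum_bernstein_weight n).
  rewrite -sumrMnl; apply: ler_sum => k _; have := ltn_ord k.
  rewrite ltnS leq_eqVlt => /orP[/eqP -> //|kn].
  by rewrite ffact_small // mulr0n mulrn_wge0 // bernstein_weight_ge0.
pose D : R := (n ^ 2)%:R * N%:R ^+ n / N%:R.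
have pD k : (k <= N)%N -> (k ^_ n)%:R <= (k%:R ^+ n : R) /\
    (k%:R ^+ n : R) <= (k ^_ n)%:R + D.
  move=> kN; rewrite -!natrX; split.
    rewrite ler_nat; elim: n {D LX0 LX1 S} => // n h.
    by rewrite ffactnSr expnSr leq_mul // leq_subr.
  rewrite -(ler_pM2r NR) mulrDl /D divfK ?gt_eqF // -natrX -!natrM -natrD ler_nat.
  exact: pow_le_ffact.
have ST : L 'X^n * (N ^_ n)%:R <= S <= L 'X^n * (N ^_ n)%:R + D.
  rewrite mulr_natr -sum_bernstein_ffact -[D]mul1r -(sum_bernstein_weight N) mulr_suml.
  rewrite -big_split /=; apply/andP; split; apply: ler_sum => k _.
    by rewrite -[leLHS]mulr_natr ler_wpM2l //; have [] := pD k (ltn_ord k).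
  by rewrite -[X in _ <= X + _]mulr_natr -mulrDr ler_wpM2l //; have [] := pD k (ltn_ord k).
have [N1 N2] := pD N (leqnn N).
have Nn : 0 < N%:R ^+ n :> R by rewrite exprn_gt0.
have -> : \sum_(k < N.+1) bernstein_weight N k * (k%:R / N%:R) ^+ n
    = S / N%:R ^+ n.
  by rewrite mulr_suml; apply: eq_bigr => k _; rewrite expr_div_n mulrA.
have -> : S / N%:R ^+ n - L 'X^n = (S - L 'X^n * N%:R ^+ n) / N%:R ^+ n.
  by rewrite mulrBl mulfK ?gt_eqF.
rewrite normrM normfV (gtr0_norm Nn) ler_pdivrMr //.
rewrite (mulrAC (n ^ 2)%:R) -/D.
case/andP: ST => ST1 ST2.
have DL : L 'X^n * D <= D.
  have D0 : 0 <= D by rewrite -(lerD2l (N ^_ n)%:R) addr0 (le_trans N1).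
  by rewrite -[leRHS]mul1r ler_wpM2r.
have LN1 : L 'X^n * (N ^_ n)%:R <= L 'X^n * N%:R ^+ n by rewrite ler_wpM2l.
have LN2 : L 'X^n * N%:R ^+ n <= L 'X^n * (N ^_ n)%:R + L 'X^n * D.
  by rewrite -mulrDr ler_wpM2l.
rewrite ler_distl; apply/andP; split.
  rewrite lerBlDr; apply: le_trans LN2 _.
  exact: lerD ST1 DL.
by apply: le_trans ST2 _; rewrite lerD2r.
Qed.

Lemma cvg_bernstein_moment n :
  (fun N => \sum_(k < N.+2) bernstein_weight N.+1 k * (k%:R / N.+1%:R) ^+ n) @ \oo
  --> L 'X^n.
Proof.
apply/cvgrPdist_le => e e0; near=> N.
rewrite distrC; apply: le_trans (bernstein_moment_error n (ltn0Sn N)) _.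
rewrite ler_pdivrMr ?ltr0n // mulrC -ler_pdivrMr //.
apply: (@le_trans _ _ N%:R); last by rewrite ler_nat.
near: N; exact: nbhs_infty_ger.
Unshelve. all: by end_near. Qed.

End PositiveFunctional.

End Bernstein.

(** * Existence of an eta-diagonal distribution *)

Section Realization.
Variable R : realType.
Local Notation C := R[i].

(** The constant function 1 in the orthonormal basis of normalised indicators of the atoms. *)
Definition weight_row (L : {scalar {poly R}}) N : 'rV[C]_N.+2 :=
  \row_j (Num.sqrt (bernstein_weight L N.+1 j))%:C%C.

Definition node_row (B : R) N : 'rV[C]_N.+2 :=
  \row_j (Num.sqrt (B * (j%:R / N.+1%:R)))%:C%C.

Lemma weight_row_real L N :
  (weight_row L N ^ Num.conj)%sesqui = weight_row L N.
Proof. by apply/rowP => j; rewrite !mxE; apply: conj_Creal; apply/complex_realP; eexists. Qed.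

Lemma node_row_real B N : (node_row B N ^ Num.conj)%sesqui = node_row B N.
Proof. by apply/rowP => j; rewrite !mxE; apply: conj_Creal; apply/complex_realP; eexists. Qed.

Lemma sqr_weight_row L N j : hausdorff_positive L ->
  weight_row L N 0 j ^+ 2 = (bernstein_weight L N.+1 j)%:C%C.
Proof.
by move=> L0; rewrite mxE -rmorphXn sqr_sqrtr // bernstein_weight_ge0.
Qed.

Lemma sqr_node_row B N j : 0 <= B ->
  node_row B N 0 j ^+ 2 = (B * (j%:R / N.+1%:R))%:C%C.
Proof.
by move=> B0; rewrite mxE -rmorphXn sqr_sqrtr // mulr_ge0 ?divr_ge0 ?ler0n.
Qed.

Lemma weight_row_unit L N : hausdorff_positive L ->
  weight_row L N *m (weight_row L N)^T = 1%:M.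
Proof.
move=> L0; rewrite [LHS]mx11_scalar; congr (_%:M); rewrite mxE.
transitivity (\sum_j weight_row L N 0 j ^+ 2).
  by apply: eq_bigr => j _; rewrite [_^T _ _]mxE expr2.
under eq_bigr do rewrite sqr_weight_row //.
by rewrite -rmorph_sum sum_bernstein_weight.
Qed.

Lemma node_row_le B N j : 0 <= B -> `|node_row B N 0 j| <= (Num.sqrt B)%:C%C.
Proof.
move=> B0; rewrite mxE ger0_norm ?lecR ?sqrtr_ge0 //.
apply: ler_wsqrtr; rewrite ler_piMr // ler_pdivrMr ?ltr0n // mul1r ler_nat.
by rewrite -ltnS.
Qed.

Section Fam.
Variables (L1 L2 : {scalar {poly R}}) (B : R).
Hypothesis L1_pos : hausdorff_positive L1.
Hypothesis L2_pos : hausdorff_positive L2.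
Hypothesis B_ge0 : 0 <= B.

Definition model_size (k : nat) : nat := ((k.+2 + k.+2) + (k.+2 + k.+2))%N.

Definition model_fam : mxfam C model_size := fun k =>
  model_op (weight_row L1 k) (weight_row L2 k) (node_row B k) (node_row B k).

Lemma model_fam_bounded : bounded_fam model_fam.
Proof.
apply/bounded_famP; exists (6 * (Num.sqrt B)%:C%C).
  by rewrite mulr_ge0 // lecR sqrtr_ge0.
move=> k; apply: opbound_model_op => [||||||j]; last 1 first.
- exact: node_row_le.
- exact: weight_row_real.
- exact: weight_row_real.
- exact: weight_row_unit.
- exact: weight_row_unit.
- by rewrite lecR sqrtr_ge0.
- by move=> j; exact: node_row_le.
Qed.

Lemma cvg_quadrature L m : hausdorff_positive L ->
  ucvg (fun k => \sum_j weight_row L k 0 j ^+ 2 * (node_row B k 0 j ^+ 2) ^+ m)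
    (B ^+ m * L 'X^m)%:C%C.
Proof.
move=> L0; pose S k := \sum_(j < k.+2)
  bernstein_weight L k.+1 j * (j%:R / k.+1%:R) ^+ m.
have -> : (fun k => \sum_j weight_row L k 0 j ^+ 2 * (node_row B k 0 j ^+ 2) ^+ m)
    = (fun k => (B ^+ m * S k)%:C%C).
  apply/funext => k; rewrite /S mulr_sumr rmorph_sum; apply: eq_bigr => j _.
  by rewrite sqr_weight_row // sqr_node_row // -rmorphXn -rmorphM exprMn mulrCA.
by apply: ucvg_real; apply: cvgMr; exact: cvg_bernstein_moment.
Qed.

Lemma eta_diagonal_exists : exists mu : {scalar ncpoly R},
  [/\ Dc mu, eta_diagonal mu,
      forall m, mu ((ncZ R * ncZs R) ^+ m) = (B ^+ m * L1 'X^m)%:C%C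
    & forall m, mu ((ncZs R * ncZ R) ^+ m) = (B ^+ m * L2 'X^m)%:C%C].
Proof.
pose a : fam_space R model_size := BFam model_fam_bounded.
have [mu amu] := star_distribution_exists a.
have adj k : ((model_fam k ^t Num.conj)%sesqui)
    = model_adj (weight_row L1 k) (weight_row L2 k) (node_row B k) (node_row B k).
  by apply: model_opH; rewrite ?weight_row_real ?node_row_real.
exists mu; split.
- by exists (fam_space R model_size), a.
- move=> w w0 naw; apply: ucvg_unique (ucvg_fam_eta amu w) _.
  have -> : (fun k => boolean_cumulant (model_fam k)
      ((model_fam k ^t Num.conj)%sesqui) w) = (fun=> 0).
    by apply/funext => k; rewrite adj; apply: model_diagonal.
  exact: ucvg_cst.
- move=> m; rewrite -wpow_altl; apply: ucvg_unique (ucvg_fam_moment amu _) _.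
  have := cvg_quadrature m L1_pos; congr ucvg; apply/funext => k.
  rewrite [bfam_val _ _]/(model_fam k) adj model_moment1 //.
  exact: weight_row_unit.
- move=> m; rewrite -wpow_altr; apply: ucvg_unique (ucvg_fam_moment amu _) _.
  have := cvg_quadrature m L2_pos; congr ucvg; apply/funext => k.
  rewrite [bfam_val _ _]/(model_fam k) adj model_moment2 //.
  exact: weight_row_unit.
Qed.

End Fam.
End Realization.

(** * Moments of compactly supported measures *)

Section MomentFunctional.
Variable R : realType.
Implicit Types (s : probability (measurableTypeR R) R) (B : R) (p : {poly R}).

Definition concentrated s B := s (~` `[0, B]) = 0%E.

(** Every larger [B] is allowed so that two measures can be placed in one interval. *)
Lemma Pcplus_concentrated s : Pcplus s ->
  exists2 B0, 0 < B0 & forall B, B0 <= B -> concentrated s B.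
Proof.
case=> _ [K [cK K0 sK]].
have [M [_ MK]] := compact_bounded cK.
exists (`|M| + 1) => [|B MB]; first by rewrite ltr_wpDl.
have KB : ~` `[0, B] `<=` ~` K.
  apply: subsetC => t Kt; have := K0 t Kt; rewrite /= !in_itv /= andbT => -> /=.
  apply: le_trans (ler_norm _) (le_trans _ MB); apply: (MK (`|M| + 1)) => //.
  by rewrite (le_lt_trans (ler_norm M)) // ltrDl.
apply/eqP; rewrite eq_le measure_ge0 andbT.
have <- : s (~` K) = 0%E by [].
apply: le_measure => //; rewrite inE; apply: measurableC; first exact: measurable_itv.
exact: measurable_realfun.compact_measurable.
Qed.

Lemma concentrated1 s B : concentrated s B -> s `[0, B]%classic = 1%E.
Proof.
move=> sB; have := probability_setT s.
rewrite -(setUv `[0, B]%classic) measureU //.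
- by rewrite [X in (_ + X)%E]sB adde0.
- by apply: measurableC; exact: measurable_itv.
- exact: setICr.
Qed.

Lemma poly_bounded p B t : 0 <= t <= B ->
  `|p.[t]| <= \sum_(i < size p) `|p`_i| * B ^+ i.
Proof.
case/andP=> t0 tB; rewrite horner_coef; apply: le_trans (ler_norm_sum _ _ _) _.
apply: ler_sum => i _; rewrite normrM ler_wpM2l // normrX lerXn2r ?nnegrE //.
  by rewrite (le_trans t0).
by rewrite ger0_norm.
Qed.

Lemma poly_integrable s p B : s.-integrable `[0, B] (EFin \o horner p).
Proof.
apply: measurable_bounded_integrable => //.
- by apply: le_lt_trans (probability_le1 _ _) (ltry _).
- exact: measurable_poly.
- exists (\sum_(i < size p) `|p`_i| * B ^+ i); split; first exact: num_real.
  move=> M pM t /=; rewrite in_itv /= => tB.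
  exact: le_trans (poly_bounded p tB) (ltW pM).
Qed.

Lemma moment_concentrated s B n : concentrated s B ->
  \int[s]_(t in `[0, +oo[) (t ^+ n) = \int[s]_(t in `[0, B]) (t ^+ n).
Proof.
move=> sB; rewrite /Rintegral; congr fine.
transitivity (\int[s]_(t in `[0%R, +oo[ `\` ~` `[0%R, B]) (t ^+ n)%:E)%E.
  apply: ge0_negligible_integral => //.
  - by apply: measurableC; exact: measurable_itv.
  - by apply/measurable_realfun.measurable_EFinP; exact: measurable_realfun.exprn_measurable.
  - by move=> t; rewrite /= in_itv /= andbT => t0; rewrite lee_fin exprn_ge0.
congr (integral _ _ _); rewrite setDE setCK; apply/seteqP; split=> t /=.
  by case.
by rewrite !in_itv /= => /andP[-> ->].
Qed.

Variables (s : probability (measurableTypeR R) R) (B : R).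
Hypothesis (B_gt0 : 0 < B) (sB : concentrated s B).

Definition scaled (p : {poly R}) : {poly R} := p \Po (B^-1 *: 'X).

Definition moment_functional (p : {poly R}) : R :=
  \int[s]_(t in `[0, B]) (scaled p).[t].

Fact moment_functional_is_scalar : scalar moment_functional.
Proof.
move=> c p q; rewrite /moment_functional /scaled.
under eq_Rintegral do rewrite comp_polyD comp_polyZ hornerD hornerZ.
rewrite RintegralD //; first last.
- exact: poly_integrable.
- have := poly_integrable s (c *: scaled p) B; congr (_.-integrable _ _).
  by apply/funext => t /=; rewrite hornerZ.
by rewrite RintegralZl //; exact: poly_integrable.
Qed.

HB.instance Definition _ := GRing.isLinear.Build R {poly R} R *%R
  moment_functional moment_functional_is_scalar.

Lemma scaledE p t : (scaled p).[t] = p.[t / B].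
Proof. by rewrite horner_comp hornerZ hornerX mulrC. Qed.

Lemma moment_functional_pos : hausdorff_positive moment_functional.
Proof.
split.
  rewrite /= /moment_functional; under eq_Rintegral do rewrite scaledE hornerC.
  by rewrite Rintegral_cst //= mul1r (concentrated1 sB).
move=> k j; apply: Rintegral_ge0 => t; rewrite /= in_itv /= => /andP[t0 tB].
rewrite scaledE hornerM !horner_exp hornerD hornerN hornerC hornerX.
apply: mulr_ge0; apply: exprn_ge0; first by rewrite divr_ge0 // ltW.
by rewrite subr_ge0 ler_pdivrMr // mul1r.
Qed.

Lemma moment_functionalE n :
  B ^+ n * moment_functional 'X^n = \int[s]_(t in `[0, +oo[) (t ^+ n).
Proof.
rewrite (moment_concentrated _ sB) /moment_functional -RintegralZl //; last first.
  exact: poly_integrable.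
apply: eq_Rintegral => t _; rewrite scaledE hornerXn expr_div_n mulrC divfK //.
by rewrite expf_neq0 // gt_eqF.
Qed.

End MomentFunctional.

(** The agreement must hold on all sets, Borel or not; [borel_normalized] supplies it outside the
    Borel sets. *)
Lemma probability_ext (R : realType) (s s' : probability (measurableTypeR R) R) :
  (forall A, s A = s' A) -> s = s'.
Proof.
case: s s' => f cf [g cg] /= /funext fg; case: _ / fg cg => cg.
case: cf cg => [[a1 a2] [a3] [a4] [a5] [a6] [a7] [a8]].
move=> [[b1 b2] [b3] [b4] [b5] [b6] [b7] [b8]].
have e1 := Prop_irrelevance a1 b1; have e2 := Prop_irrelevance a2 b2; subst b1 b2.
have e3 := Prop_irrelevance a3 b3; subst b3.
have e4 := Prop_irrelevance a4 b4; subst b4.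
have e5 := Prop_irrelevance a5 b5; subst b5.
have e6 := Prop_irrelevance a6 b6; subst b6.
have e7 := Prop_irrelevance a7 b7; subst b7.
have e8 := Prop_irrelevance a8 b8; subst b8.
by [].
Qed.

(** * Determinacy of measures on a bounded interval *)

Section Determinacy.
Variable R : realType.
Implicit Types (s : probability (measurableTypeR R) R) (B : R) (p : {poly R}).

Lemma bernoulli_ge (u : R) m : 0 <= u <= 1 -> 1 - m%:R * u <= (1 - u) ^+ m.
Proof.
case/andP=> u0 u1; elim: m => [|m IH]; first by rewrite mul0r subr0 expr0.
have v0 : 0 <= 1 - u by rewrite subr_ge0.
rewrite exprS; apply: le_trans (ler_wpM2l v0 IH).
rewrite -natr1 -subr_ge0.
have -> : (1 - u) * (1 - m%:R * u) - (1 - (m%:R + 1) * u) = m%:R * u ^+ 2 by ring.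
by rewrite mulr_ge0 // sqr_ge0.
Qed.

(** The stronger inequality (1 + m u) (1 - u)^m <= 1 is the one that goes through by induction. *)
Lemma bernoulli_le (u : R) m : 0 <= u <= 1 -> m%:R * u * (1 - u) ^+ m <= 1.
Proof.
case/andP=> u0 u1; have v0 : 0 <= 1 - u by rewrite subr_ge0.
suff h : (1 + m%:R * u) * (1 - u) ^+ m <= 1.
  by apply: le_trans h; rewrite ler_wpM2r ?exprn_ge0 // lerDr.
elim: m => [|m IH]; first by rewrite mul0r addr0 mul1r expr0.
apply: le_trans IH; rewrite exprS mulrA ler_wpM2r ?exprn_ge0 //.
rewrite -natr1 -subr_ge0.
have -> : 1 + m%:R * u - (1 + (m%:R + 1) * u) * (1 - u)
    = (m%:R + 1) * u ^+ 2 by ring.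
by rewrite mulr_ge0 ?addr_ge0 // sqr_ge0.
Qed.

(* With z strictly between a and b and m of the order of z^-n, the polynomial
   (1 - t^n)^m tends to 1 on [0, a] and to 0 on [b, 1]. *)
Lemma poly_step (a b e : R) : 0 <= a < b -> b <= 1 -> 0 < e ->
  exists n m, (forall u, 0 <= u <= a -> 1 - e <= (1 - u ^+ n) ^+ m) /\
              (forall u, b <= u <= 1 -> (1 - u ^+ n) ^+ m <= e).
Proof.
case/andP=> a0 ab b1 e0.
have [z [az zb]] : exists z, a < z /\ z < b.
  by exists ((a + b) / 2); rewrite !midf_lt.
have z0 : 0 < z by exact: le_lt_trans az.
have b0 : 0 < b by exact: lt_trans zb.
(* For m between z^-n and 2 z^-n, m u^n is at most 2 (a / z)^n on [0, a], and 1 / (m u^n) is at most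
   (z / b)^n on [b, 1]; both are bounded by 2 r^n. *)
pose r := Num.max (a / z) (z / b).
have r0 : 0 <= r by rewrite le_max divr_ge0 // ltW.
have r1 : r < 1 by rewrite gt_max !ltr_pdivrMr // !mul1r az zb.
have [n rn] : exists n, 2 * r ^+ n <= e.
  have r1' : `|r| < 1 by rewrite ger0_norm.
  have e20 : 0 < e / 2 by rewrite divr_gt0.
  move/cvgrPdist_le: (cvg_expr r1') => /(_ _ e20)[n _ /(_ n (leqnn n))].
  rewrite sub0r normrN ger0_norm ?exprn_ge0 // => h; exists n.
  by rewrite mulrC -ler_pdivlMr.
have rn0 : 0 <= r ^+ n by rewrite exprn_ge0.
have zn : 0 < z ^+ n by rewrite exprn_gt0.
have zn1 : 1 <= z ^- n by rewrite invf_ge1 // exprn_ile1 // ltW // (lt_le_trans zb).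
pose m := (Num.truncn (z ^- n)).+1.
have m1 : z ^- n <= m%:R by rewrite ltW // truncnS_gt.
have m2 : m%:R <= 2 * z ^- n.
  by rewrite /m -natr1 mulr2n mulrDl mul1r lerD // truncn_le (le_trans ler01).
exists n, m; split=> u /andP[u0 u1].
  have u01 : 0 <= u ^+ n <= 1.
    by rewrite exprn_ge0 // exprn_ile1 // (le_trans u1) // (le_trans (ltW ab)).
  apply: le_trans (bernoulli_ge m u01); rewrite lerD2l lerN2.
  apply: le_trans rn; apply: (@le_trans _ _ (2 * z ^- n * a ^+ n)).
    by apply: ler_pM => //; [case/andP: u01 | rewrite lerXn2r ?nnegrE // (le_trans u0)].
  rewrite -mulrA ler_wpM2l // mulrC -expr_div_n; apply: lerXn2r; rewrite ?nnegrE //.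
    by rewrite divr_ge0 // ltW.
  by rewrite le_max lexx.
have u0' : 0 < u by exact: lt_le_trans u0.
have u01 : 0 <= u ^+ n <= 1 by rewrite exprn_ge0 ?exprn_ile1 // ltW.
have v0 : 0 <= (1 - u ^+ n) ^+ m by rewrite exprn_ge0 // subr_ge0; case/andP: u01.
have bz : 0 < (b / z) ^+ n by rewrite exprn_gt0 // divr_gt0.
apply: (@le_trans _ _ ((z / b) ^+ n)).
  rewrite -[z / b]invf_div exprVn -[leRHS]mul1r ler_pdivlMr // mulrC.
  apply: le_trans (bernoulli_le m u01); rewrite ler_wpM2r // expr_div_n mulrC.
  apply: ler_pM => //; first by rewrite invr_ge0 ltW.
    by rewrite exprn_ge0 // ltW.
  by apply: lerXn2r; rewrite ?nnegrE // ltW.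
apply: le_trans rn; apply: (@le_trans _ _ (r ^+ n)).
  by apply: lerXn2r; rewrite ?nnegrE ?le_max ?lexx ?orbT // divr_ge0 // ltW.
by rewrite mulr2n mulrDl mul1r lerDl.
Qed.

Lemma concentratedI s B (A : set R) : concentrated s B -> measurable A ->
  s (A `&` `[0, B]) = s A.
Proof.
move=> sB mA.
have mB : measurable (`[0, B]%classic : set (measurableTypeR R)) by exact: measurable_itv.
rewrite -[in RHS](setIT A) -(setUv `[0, B]%classic) setIUr measureU //.
- rewrite [X in (_ + X)%E](_ : _ = 0%E) ?adde0 //.
  apply/eqP; rewrite eq_le measure_ge0 andbT -sB.
  by apply: le_measure; rewrite ?inE //; [apply: measurableI => //|];
    apply: measurableC.
- exact: measurableI.
- by apply: measurableI => //; apply: measurableC.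
- by rewrite setIACA setICr setI0.
Qed.

Lemma indic_integrable s (D A : set R) : measurable D -> measurable A ->
  s.-integrable D (EFin \o (\1_A : R -> R)).
Proof.
move=> mD mA; apply: integrableS (integrable_indic s mA) => //.
Qed.

Lemma Rintegral_indic s B (A : set R) : concentrated s B -> measurable A ->
  \int[s]_(t in `[0, B]) (\1_A t) = fine (s A).
Proof.
move=> sB mA; rewrite /Rintegral integral_indic //; congr fine.
exact: concentratedI.
Qed.

(** Equal moments give equal integrals of the polynomial of [poly_step], which lies above (1 - e/2)
    times the indicator of [0, x] and below the indicator of [0, y] plus e/2. The gap between x and
    y is its transition zone. *)
Lemma cdf_moments_le s s' B x y : concentrated s B -> concentrated s' B ->
  0 < B ->
  (forall n, \int[s]_(t in `[0, +oo[) (t ^+ n)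
           = \int[s']_(t in `[0, +oo[) (t ^+ n)) ->
  x < y -> fine (s `]-oo, x]%classic) <= fine (s' `]-oo, y]%classic).
Proof.
move=> sB sB' B0 mom xy.
have fin (u : probability (measurableTypeR R) R) A : measurable A ->
    0 <= fine (u A) <= 1.
  move=> mA; rewrite fine_ge0 //=.
  by rewrite -lee_fin fineK ?fin_num_measure // probability_le1.
(* [poly_step] needs 0 <= x and y <= B. For x < 0 the left side is 0, and for y >= B the right side
   is 1. *)
have [x0|x0] := ltP x 0.
  rewrite -(concentratedI sB) // [_ `&` _](_ : _ = set0).
    by rewrite measure0 fine_ge0.
  apply/seteqP; split=> // t /= []; rewrite !in_itv /= => tx /andP[t0 _].
  by have := lt_le_trans x0 (le_trans t0 tx); rewrite ltxx.
have [By|yB] := leP B y.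
  rewrite -(concentratedI sB' (A := `]-oo, y]%classic)) // setIidr; last first.
    by move=> t /=; rewrite !in_itv /= => /andP[_ tB]; exact: le_trans By.
  rewrite (concentrated1 sB') /=.
  by have /andP[] := fin s `]-oo, x]%classic (measurable_itv _).
apply/ler_addgt0Pr => e e0; have e20 : 0 < e / 2 by rewrite divr_gt0.
have [||| n [m [h1 h2]]] := @poly_step (x / B) (y / B) (e / 2).
- by rewrite divr_ge0 //= ?ltr_pM2r ?invr_gt0 // ltW.
- by rewrite ler_pdivrMr // mul1r ltW.
- by [].
pose q : {poly R} := (1 - 'X^n) ^+ m.
have qE t : (scaled B q).[t] = (1 - (t / B) ^+ n) ^+ m.
  by rewrite scaledE // horner_exp hornerD hornerN hornerC hornerXn.
have lin (u : probability (measurableTypeR R) R) (c : R) (p : {poly R}) :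
  moment_functional u B (c *: p) = c * moment_functional u B p.
  exact: linearZ_LR.
have qq : moment_functional s B q = moment_functional s' B q.
  rewrite -[q]coefK poly_def !raddf_sum; apply: eq_bigr => i _.
  rewrite /= !lin; congr (_ * _).
  apply: (mulfI (_ : B ^+ i != 0)); first by rewrite expf_neq0 // gt_eqF.
  by rewrite !moment_functionalE.
have tB01 t : t \in `[0, B] -> 0 <= (t / B) ^+ n <= 1.
  rewrite in_itv /= => /andP[t0 tB].
  by rewrite exprn_ge0 ?exprn_ile1 ?divr_ge0 ?ler_pdivrMr ?mul1r //; exact: ltW.
have mI z : measurable (`]-oo, z]%classic : set R) by exact: measurable_itv.
have le1 : (1 - e / 2) * fine (s `]-oo, x]%classic) <= moment_functional s B q.
  rewrite -(Rintegral_indic sB) // -RintegralZl //; last exact: indic_integrable.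
  apply: le_Rintegral => //; last 1 first.
  - move=> t tB; rewrite qE indicE; have /andP[q0 q1] := tB01 _ tB.
    have [|_] := boolP (t \in _); last by rewrite mulr0 exprn_ge0 // subr_ge0.
    rewrite inE /= in_itv /= => tx; rewrite mulr1; apply: h1.
    move: tB; rewrite /= in_itv /= => /andP[t0 tB].
    by rewrite divr_ge0 //= ?ler_pM2r ?invr_gt0 // ltW.
  - have := integrableZl _ (1 - e / 2) (indic_integrable s (measurable_itv `[0, B]) (mI x)).
    by apply.
  - exact: poly_integrable.
have le2 : moment_functional s' B q <= fine (s' `]-oo, y]%classic) + e / 2.
  rewrite -(Rintegral_indic sB') //.
  have <- : \int[s']_(t in `[0, B]) (e / 2) = e / 2.
    by rewrite Rintegral_cst //= (concentrated1 sB') mulr1.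
  have ic : s'.-integrable `[0, B] (EFin \o (fun=> e / 2)).
    have := poly_integrable s' (e / 2)%:P B; congr (_.-integrable _ _).
    by apply/funext => t /=; rewrite hornerC.
  rewrite -RintegralD //; last exact: indic_integrable.
  apply: le_Rintegral => //; last 1 first.
  - move=> t tB; rewrite qE indicE; have /andP[q0 q1] := tB01 _ tB.
    have [_|] := boolP (t \in _).
      apply: ler_wpDr; first exact: ltW.
      by apply: exprn_ile1; rewrite ?subr_ge0 // lerBlDr lerDl.
    rewrite notin_setE /= in_itv /= => /negP; rewrite -ltNge add0r => yt.
    apply: h2; move: tB; rewrite /= in_itv /= => /andP[t0 tB].
    apply/andP; split; last by rewrite ler_pdivrMr // mul1r.
    by rewrite ler_pM2r ?invr_gt0 // ltW.
  - exact: poly_integrable.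
  - have mB : measurable (`[0, B]%classic : set (measurableTypeR R)).
      exact: measurable_itv.
    have := integrableD mB (indic_integrable s' mB (mI y)) ic.
    by congr (_.-integrable _ _); apply/funext => t /=; rewrite EFinD.
(* Since the mass [S] is at most 1, (1 - e/2) S >= S - e/2, and the total loss is [e]. *)
have := fin s `]-oo, x]%classic (measurable_itv _).
move: le1 le2; rewrite qq; move: (fine (s _)) (fine (s' _)) (moment_functional _ _ _).
move=> S S' l; nra.
Qed.

(** Continuity from above along x + 1/(n+1) closes the gap in [cdf_moments_le]; half-open intervals
    then generate the Borel sets. *)
Lemma probability_moments_unique s s' B : concentrated s B -> concentrated s' B ->
  0 < B ->
  (forall n, \int[s]_(t in `[0, +oo[) (t ^+ n)
           = \int[s']_(t in `[0, +oo[) (t ^+ n)) ->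
  forall A, measurable A -> s A = s' A.
Proof.
move=> sB sB' B0 mom.
have cdf_le u u' : concentrated u B -> concentrated u' B ->
    (forall n, \int[u]_(t in `[0, +oo[) (t ^+ n)
             = \int[u']_(t in `[0, +oo[) (t ^+ n)) ->
    forall x, fine (u `]-oo, x]%classic) <= fine (u' `]-oo, x]%classic).
  move=> uB uB' umom x.
  pose F n : set (measurableTypeR R) := `]-oo, x + n.+1%:R^-1]%classic.
  have mF n : measurable (F n) by exact: measurable_itv.
  rewrite fine_le ?fin_num_measure //.
  have uF n : (u `]-oo, x]%classic <= u' (F n))%E.
    rewrite -[leLHS]fineK ?fin_num_measure // -[leRHS]fineK ?fin_num_measure //.
    by rewrite lee_fin (cdf_moments_le uB uB') // ltrDl.
  have cF : u' (F n) @[n --> \oo] --> u' `]-oo, x]%classic.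
    suff : u' (F n) @[n --> \oo] --> u' (\bigcap_n F n) by rewrite -itvNycEbigcap.
    apply: nonincreasing_cvg_mu => [|//| |m n mn].
    - by rewrite -ge0_fin_numE // fin_num_measure.
    - exact: bigcap_measurable.
    - apply/subsetPset; apply: subset_itvl.
      by rewrite bnd_simp lerD2l lef_pV2 ?posrE // ler_nat.
  rewrite -(cvg_lim _ cF) //; apply: lime_ge; first by apply/cvg_ex; eexists; exact: cF.
  exact: nearW.
have cdf_eq x : s `]-oo, x]%classic = s' `]-oo, x]%classic.
  rewrite -[LHS]fineK ?fin_num_measure // -[RHS]fineK ?fin_num_measure //.
  by congr EFin; apply: le_anti; rewrite !cdf_le.
apply: (@measure_unique _ R (measurableTypeR R) (@ocitv R) (fun n => `](- n%:R), n%:R]%classic)) => //.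
- exact: ocitvI.
- by move=> n; exact: is_ocitv.
- by rewrite (bigcup_itvT false false).
- move=> A /ocitvP[->|[[a b] /= ab ->]]; first by rewrite !measure0.
  have : `]a, b]%classic = `]-oo, b] `\` `]-oo, a] :> set R => [|->].
    by rewrite -[RHS]setCK setCD setCitvl setUC -[LHS]setCK setCitv.
  rewrite !measureD ?setIidr //; try exact: measurable_itv.
  + by congr (_ - _)%E; exact: cdf_eq.
  + by apply: subset_itvl; rewrite bnd_simp ltW.
  + exact: le_lt_trans (probability_le1 _ _) (ltry _).
  + exact: le_lt_trans (probability_le1 _ _) (ltry _).
- by move=> n; apply: le_lt_trans (probability_le1 _ _) (ltry _).
Qed.

End Determinacy.

(** * The Hausdorff moment problem *)

Section StepFunction.
Variables (R : realFieldType) (B : R) (M n : nat).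
Hypotheses (B_gt0 : 0 < B) (M_gt0 : (0 < M)%N).
Let B_ge0 : 0 <= B := ltW B_gt0.

Definition grid (i : nat) : R := B * (i%:R / M%:R).
Definition grid_gap i : R := grid i.+1 ^+ n.+1 - grid i ^+ n.+1.
(** It rounds [t] up to the next grid point before taking the power. Being a combination of
    indicators of rays, it has an integral expressed by the distribution function; the positive
    exponent makes the sum start from 0. *)
Definition step_fun (t : R) : R := \sum_(i < M) grid_gap i * (grid i < t)%R%:R.
(** Bound for one jump: the grid spacing times the maximum on [0, B] of the derivative of the
    power. *)
Definition mesh : R := B / M%:R * (n.+1%:R * B ^+ n).

Let M_R : 0 < M%:R :> R. Proof. by rewrite ltr0n. Qed.

Lemma grid_ge0 i : 0 <= grid i.
Proof. by rewrite mulr_ge0 // divr_ge0. Qed.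

Lemma grid_le i j : (i <= j)%N -> grid i <= grid j.
Proof. by move=> ij; rewrite ler_wpM2l // ler_pM2r ?invr_gt0 // ler_nat. Qed.

Lemma gridM : grid M = B.
Proof. by rewrite /grid divff ?mulr1 // gt_eqF. Qed.

Lemma grid_gap_ge0 i : 0 <= grid_gap i.
Proof. by rewrite subr_ge0 lerXn2r ?nnegrE ?grid_ge0 // grid_le. Qed.

Lemma grid_gap_le i : (i < M)%N -> grid_gap i <= mesh.
Proof.
move=> iM; have gB j : (j <= M)%N -> grid j <= B.
  by move=> jM; rewrite -gridM grid_le.
rewrite /grid_gap subrXX /mesh.
have -> : grid i.+1 - grid i = B / M%:R.
  by rewrite /grid -mulrBr -mulrBl -natr1 addrAC subrr add0r mul1r.
apply: ler_wpM2l; first by rewrite divr_ge0.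
rewrite mulr_natl -[n.+1 in leRHS]card_ord -sumr_const; apply: ler_sum => j _.
have -> : B ^+ n = B ^+ (n.+1.-1 - j) * B ^+ j.
  by rewrite -exprD subnK // -ltnS.
by apply: ler_pM; rewrite ?exprn_ge0 ?grid_ge0 // lerXn2r ?nnegrE ?grid_ge0 // gB // ltnW.
Qed.

Lemma step_fun_bounds t : 0 <= t <= B -> t ^+ n.+1 <= step_fun t <= t ^+ n.+1 + mesh.
Proof.
case/andP=> t0 tB.
have mesh0 : 0 <= mesh by rewrite !mulr_ge0 ?invr_ge0 ?exprn_ge0.
pose S m := \sum_(i < m) grid_gap i * (grid i < t)%R%:R.
have S_rec m : S m.+1 = S m + grid_gap m * (grid m < t)%R%:R by rewrite /S big_ord_recr.
have S_eq m : grid m <= t -> S m = grid m ^+ n.+1.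
  elim: m => [|m IH] gt; first by rewrite /S big_ord0 /grid mul0r mulr0 expr0n.
  have gm : grid m < t.
    by apply: lt_le_trans gt; rewrite ltr_pM2l // ltr_pM2r ?invr_gt0 // ltr_nat.
  by rewrite S_rec gm mulr1 (IH (ltW gm)) /grid_gap addrC subrK.
have S_lo m : t <= grid m -> t ^+ n.+1 <= S m.
  elim: m => [|m IH] tg.
    have -> : t = 0 by apply: le_anti; rewrite t0 andbT; move: tg; rewrite /grid mul0r mulr0.
    by rewrite expr0n /S big_ord0.
  rewrite S_rec; have [gt|tg'] := ltP (grid m) t; last by rewrite mulr0 addr0 IH.
  rewrite mulr1 (S_eq _ (ltW gt)) /grid_gap addrC subrK.
  by rewrite lerXn2r ?nnegrE ?grid_ge0.
have S_hi m : (m <= M)%N -> S m <= t ^+ n.+1 + mesh.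
  elim: m => [|m IH] mM; first by rewrite /S big_ord0 addr_ge0 ?exprn_ge0.
  rewrite S_rec; have [gt|tg'] := ltP (grid m) t.
    rewrite mulr1 (S_eq _ (ltW gt)); apply: lerD; last exact: grid_gap_le.
    by rewrite lerXn2r ?nnegrE ?grid_ge0 // ltW.
  by rewrite mulr0 addr0 IH // ltnW.
by rewrite S_hi // andbT S_lo // gridM.
Qed.
End StepFunction.

(** * The limit distribution function *)

Section HausdorffCdf.
Variable R : realType.
Variables (L : {scalar {poly R}}) (B : R).
Hypotheses (L_pos : hausdorff_positive L) (B_gt0 : 0 < B).

Lemma ulim_le (x y : nat -> R) (b : R) : (forall k, `|x k| <= b) ->
  (forall k, `|y k| <= b) -> (forall k, x k <= y k) -> ulim x <= ulim y.
Proof.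
move=> xb yb xy; rewrite -subr_ge0.
have h : (fun k => y k - x k) @ nat_ultra --> ulim y - ulim x.
  by apply: cvgB; [exact: cvg_ulim yb | exact: cvg_ulim xb].
by apply: (cvgr_to_ge h); apply: filterE => k; rewrite subr_ge0.
Qed.

Lemma ulim_cst (c : R) : ulim (fun=> c) = c.
Proof. by apply: ulim_eq; exact: cvg_cst. Qed.

Definition node (N k : nat) : R := B * (k%:R / N.+1%:R).
Local Notation w N k := (bernstein_weight L N.+1 k).

Definition quad_cdf (x : R) (N : nat) : R :=
  \sum_(k < N.+2) w N k * (node N k <= x)%R%:R.

Lemma quad_cdf_ge0 x N : 0 <= quad_cdf x N.
Proof. by apply: sumr_ge0 => k _; rewrite mulr_ge0 // bernstein_weight_ge0. Qed.

Lemma quad_cdf_le1 x N : quad_cdf x N <= 1.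
Proof.
rewrite -(sum_bernstein_weight L_pos N.+1); apply: ler_sum => k _.
by rewrite ler_piMr ?bernstein_weight_ge0 // lern1 leq_b1.
Qed.

Lemma quad_cdf_bounded x N : `|quad_cdf x N| <= 1.
Proof. by rewrite ger0_norm ?quad_cdf_ge0 // quad_cdf_le1. Qed.

Lemma quad_cdf_mono x y N : x <= y -> quad_cdf x N <= quad_cdf y N.
Proof.
move=> xy; apply: ler_sum => k _; rewrite ler_wpM2l ?bernstein_weight_ge0 // ler_nat.
by have [kx|//] := leP (node N k) x; rewrite (le_trans kx xy).
Qed.

Lemma quad_cdf_lt0 x N : x < 0 -> quad_cdf x N = 0.
Proof.
move=> x0; apply: big1 => k _; rewrite leNgt (lt_le_trans x0) ?mulr0 //.
by rewrite mulr_ge0 ?divr_ge0 // ltW.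
Qed.

Lemma node_itv N (k : 'I_N.+2) : 0 <= node N k <= B.
Proof.
have B0 := ltW B_gt0; rewrite mulr_ge0 ?divr_ge0 //= ger_pMr // ler_pdivrMr ?ltr0n // mul1r ler_nat.
by rewrite -ltnS.
Qed.

Lemma quad_cdf_geB x N : B <= x -> quad_cdf x N = 1.
Proof.
move=> Bx; rewrite -(sum_bernstein_weight L_pos N.+1); apply: eq_bigr => k _.
by have /andP[_ kB] := node_itv k; rewrite (le_trans kB Bx) mulr1.
Qed.

Definition limit_cdf (x : R) : R := ulim (quad_cdf x).

Lemma cvg_limit_cdf x : quad_cdf x @ nat_ultra --> limit_cdf x.
Proof. exact: cvg_ulim (quad_cdf_bounded x). Qed.

Lemma limit_cdf_mono x y : x <= y -> limit_cdf x <= limit_cdf y.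
Proof.
move=> xy; apply: (ulim_le (b := 1)) => k; try exact: quad_cdf_bounded.
exact: quad_cdf_mono.
Qed.

Lemma limit_cdf_lt0 x : x < 0 -> limit_cdf x = 0.
Proof.
move=> x0; rewrite /limit_cdf -[RHS](ulim_cst 0); congr ulim.
by apply/funext => N; rewrite quad_cdf_lt0.
Qed.

Lemma limit_cdf_geB x : B <= x -> limit_cdf x = 1.
Proof.
move=> Bx; rewrite /limit_cdf -[RHS](ulim_cst 1); congr ulim.
by apply/funext => N; rewrite quad_cdf_geB.
Qed.

Lemma limit_cdf_ge0 x : 0 <= limit_cdf x.
Proof.
have [x0|x0] := ltP x 0; first by rewrite limit_cdf_lt0.
have m0 : -1 < 0 :> R by rewrite ltrN10.
by rewrite -(limit_cdf_lt0 m0) limit_cdf_mono // (le_trans _ x0) // ltW.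
Qed.

(** A pointwise limit of distribution functions can fail to be right-continuous at a jump. This
    right limit F satisfies G(x) <= F(x) <= G(y) for x < y, where G is [limit_cdf]. *)
Definition right_cdf (x : R) : R := inf [set limit_cdf y | y in [set y | x < y]].

Let right_cdf_lb x : has_inf [set limit_cdf y | y in [set y | x < y]].
Proof.
split; first by exists (limit_cdf (x + 1)), (x + 1) => //=; rewrite ltrDl.
by exists 0 => _ [y _ <-]; exact: limit_cdf_ge0.
Qed.

Lemma right_cdf_le x y : x < y -> right_cdf x <= limit_cdf y.
Proof. by move=> xy; apply: ge_inf; [have [] := right_cdf_lb x | exists y]. Qed.

Lemma right_cdf_ge x : limit_cdf x <= right_cdf x.
Proof.
apply: lb_le_inf; first by have [] := right_cdf_lb x.
by move=> _ [y xy <-]; apply: limit_cdf_mono; exact: ltW.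
Qed.

Lemma right_cdf_nd : nondecreasing right_cdf.
Proof.
move=> x y; rewrite le_eqVlt => /orP[/eqP->//|xy].
exact: le_trans (right_cdf_le xy) (right_cdf_ge y).
Qed.

Lemma right_cdf_rc : right_continuous right_cdf.
Proof.
move=> a; apply/cvgrPdist_le => e e0.
have [_ [y ay <-] ye] : exists2 z, [set limit_cdf y | y in [set y | a < y]] z
    & z < right_cdf a + e.
  by apply: inf_adherent => //; exact: right_cdf_lb.
near=> t.
have at_ : a < t by near: t; exact: nbhs_right_gt.
have ty : t < y by near: t; exact: nbhs_right_lt.
rewrite distrC ger0_norm; last by rewrite subr_ge0 right_cdf_nd // ltW.
by rewrite lerBlDl ltW //; exact: le_lt_trans (right_cdf_le ty) ye.
Unshelve. all: by end_near. Qed.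

HB.instance Definition _ :=
  isCumulative.Build R _ R right_cdf right_cdf_nd right_cdf_rc.

Lemma right_cdf_lt0 x : x < 0 -> right_cdf x = 0.
Proof.
move=> x0; apply: le_anti; rewrite (le_trans (limit_cdf_ge0 x) (right_cdf_ge x)) andbT.
have x2 : x / 2 < 0 by rewrite ltr_pdivrMr // mul0r.
rewrite -(limit_cdf_lt0 x2) right_cdf_le // ltr_pdivlMr //.
by rewrite mulr2n mulrDr mulr1 gtrDl.
Qed.

Lemma right_cdf_geB x : B <= x -> right_cdf x = 1.
Proof.
move=> Bx; apply: le_anti; rewrite -{2}(limit_cdf_geB Bx) right_cdf_ge andbT.
by rewrite -(@limit_cdf_geB (x + 1)) ?right_cdf_le ?ltrDl // (le_trans Bx) // lerDl.
Qed.

Lemma right_cdf_Ny : right_cdf @ -oo --> (0 : R).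
Proof.
apply/cvgrPdist_le => e e0; near=> x; rewrite right_cdf_lt0 ?subrr ?normr0; first exact: ltW.
by near: x; apply: nbhs_ninfty_lt; exact: num_real.
Unshelve. all: by end_near. Qed.

Lemma right_cdf_y : right_cdf @ +oo --> (1 : R).
Proof.
apply/cvgrPdist_le => e e0; near=> x; rewrite right_cdf_geB ?subrr ?normr0; first exact: ltW.
by near: x; apply: nbhs_pinfty_ge; exact: num_real.
Unshelve. all: by end_near. Qed.

HB.instance Definition _ :=
  isCumulativeBounded.Build R 0 1 right_cdf right_cdf_Ny right_cdf_y.

Definition hausdorff_measure : probability (measurableTypeR R) R :=
  lebesgue_stieltjes_measure right_cdf.

Lemma hausdorff_measure_cdf x :
  hausdorff_measure `]-oo, x]%classic = (right_cdf x)%:E.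
Proof. exact: cdf_lebesgue_stieltjes_id. Qed.

End HausdorffCdf.

(** * Moments of the limit measure *)

Section HausdorffMeasure.
Variable R : realType.

Lemma Rintegral_sum d (T : measurableType d) (s : {measure set T -> \bar R})
    (D : set T) (m : nat) (f : nat -> T -> R) : measurable D ->
  (forall i, s.-integrable D (EFin \o f i)) ->
  s.-integrable D (EFin \o (fun t => \sum_(i < m) f i t)) /\
  \int[s]_(t in D) (\sum_(i < m) f i t) = \sum_(i < m) \int[s]_(t in D) f i t.
Proof.
move=> mD fi; elim: m => [|m [IHi IHe]].
  have e : (fun t : T => \sum_(i < 0) f i t) = (fun=> 0).
    by apply/funext => t; rewrite big_ord0.
  rewrite e big_ord0; split; first exact: integrable0.
  by rewrite /Rintegral integral0.
have e : (fun t : T => \sum_(i < m.+1) f i t)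
    = (fun t => \sum_(i < m) f i t + f m t).
  by apply/funext => t; rewrite big_ord_recr.
rewrite e big_ord_recr /= -IHe; split; last by rewrite RintegralD.
have := integrableD mD IHi (fi m).
by congr (_.-integrable _ _); apply/funext => t /=; rewrite EFinD.
Qed.

Variables (L : {scalar {poly R}}) (B : R).
Hypotheses (L_pos : hausdorff_positive L) (B_gt0 : 0 < B).
Let B_ge0 : 0 <= B := ltW B_gt0.
Local Notation mu := (hausdorff_measure L_pos B_gt0).
Local Notation F := (right_cdf L B).
Local Notation G := (limit_cdf L B).

Lemma hausdorff_measure_concentrated : concentrated mu B.
Proof.
(* The distribution function gives the mass of closed left rays, so the open ray of negative numbers
   is exhausted by countably many of them. *)
pose A (n : nat) : set (measurableTypeR R) :=
  if n is k.+1 then `]-oo, - k.+1%:R^-1]%classic else `]B, +oo[%classic.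
have mA n : measurable (A n) by case: n => [|n]; exact: measurable_itv.
have A0 n : mu (A n) = 0%E.
  case: n => [|n]; last first.
    by rewrite hausdorff_measure_cdf right_cdf_lt0 // oppr_lt0 invr_gt0 ltr0n.
  rewrite /A -setCitvl probability_setC; last exact: measurable_itv.
  by rewrite hausdorff_measure_cdf right_cdf_geB // subee.
have cover : ~` `[0, B] `<=` \bigcup_n A n.
  move=> t; rewrite /= in_itv /= => /negP; rewrite negb_and -!ltNge => /orP[t0|Bt].
    have t0' : 0 < - t by rewrite oppr_gt0.
    exists (Num.truncn (- t)^-1).+1 => //=; rewrite in_itv /= lerNr.
    by rewrite invf_ple ?posrE ?ltr0n // ltW // truncnS_gt.
  by exists 0%N => //=; rewrite in_itv /= Bt.
apply/eqP; rewrite eq_le measure_ge0 andbT.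
have mC : measurable (~` `[0, B]%classic : set (measurableTypeR R)).
  by apply: measurableC; exact: measurable_itv.
have := measure_sigma_subadditive mu mA mC cover.
by rewrite eseries0 // => i _ _; exact: A0.
Qed.

(** The moment I of the measure is within one [mesh] of the staircase sum T(F), and m = B^n L(x^n)
    is within one [mesh] of T(G), by passage to the limit from the atoms. Comparing F with G at
    neighbouring grid points costs another [mesh], whether or not G jumps there. *)
Lemma hausdorff_measure_moment n :
  \int[mu]_(t in `[0, +oo[) (t ^+ n) = B ^+ n * L 'X^n.
Proof.
rewrite (moment_concentrated _ hausdorff_measure_concentrated).
case: n => [|n].
  have L1 : L 1 = 1 by case: L_pos.
  rewrite expr0 mul1r [RHS]L1; under eq_Rintegral do rewrite expr0.
  by rewrite Rintegral_cst //= (concentrated1 hausdorff_measure_concentrated) mul1r.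
set I := LHS; set m := RHS.
suff bound M : (0 < M)%N -> `|I - m| <= 2 * mesh B M n.
  apply/eqP; rewrite -subr_eq0 -normr_le0; apply/ler_addgt0Pr => e e0; rewrite add0r.
  pose K := 2 * B * (n.+1%:R * B ^+ n).
  apply: le_trans (bound (Num.truncn (K / e)).+1 isT) _.
  have -> : forall M, 2 * mesh B M n = K / M%:R.
    by move=> M; rewrite /mesh /K; ring.
  by rewrite ler_pdivrMr ?ltr0n // mulrC -ler_pdivrMr // ltW // truncnS_gt.
move=> M0; pose x i := grid B M i; pose D i := grid_gap B M n i.
have D0 i : 0 <= D i by apply: grid_gap_ge0.
(* For the distribution function H of a probability measure on [0, B], this is the integral of the
   staircase. *)
pose T (H : R -> R) := \sum_(i < M) D i * (1 - H (x i)).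
have muF z : fine (mu `]-oo, z]%classic) = F z by rewrite hausdorff_measure_cdf.
have stepE t : step_fun B M n t = \sum_(i < M) D i * (1 - \1_(`]-oo, x i]%classic : set R) t).
  apply: eq_bigr => i _; congr (_ * _); rewrite indicE; have [xt|tx] := ltP (x i) t.
    by rewrite memNset ?subr0 //= in_itv /= => /(lt_le_trans xt); rewrite ltxx.
  by rewrite mem_set ?subrr //= in_itv.
have mB : measurable (`[0, B]%classic : set (measurableTypeR R)) by exact: measurable_itv.
have mI z : measurable (`]-oo, z]%classic : set (measurableTypeR R)) by exact: measurable_itv.
have i1 : mu.-integrable `[0, B] (EFin \o (fun=> 1 : R)).
  have := poly_integrable mu 1%:P B; congr (_.-integrable _ _).
  by apply/funext => t /=; rewrite hornerC.
have it z : mu.-integrable `[0, B] (EFin \o (fun t => 1 - \1_(`]-oo, z]%classic : set R) t)).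
  have := integrableB mB i1 (indic_integrable mu mB (mI z)).
  by congr (_.-integrable _ _); apply/funext => t /=; rewrite EFinB.
have iD i : mu.-integrable `[0, B]
    (EFin \o (fun t => D i * (1 - \1_(`]-oo, x i]%classic : set R) t))).
  have := integrableZl mB (D i) (it (x i)).
  by congr (_.-integrable _ _); apply/funext => t /=; rewrite EFinM.
have [iS eS] := Rintegral_sum M mB iD.
have intT : \int[mu]_(t in `[0, B]) step_fun B M n t = T F.
  under eq_Rintegral do rewrite stepE.
  rewrite eS; apply: eq_bigr => i _; rewrite RintegralZl //; congr (_ * _).
  rewrite RintegralB //; last exact: indic_integrable.
  rewrite Rintegral_cst //= (concentrated1 hausdorff_measure_concentrated) mul1r.
  by rewrite (Rintegral_indic hausdorff_measure_concentrated) // muF.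
have istep : mu.-integrable `[0, B] (EFin \o step_fun B M n).
  by move: iS; congr (_.-integrable _ _); apply/funext => t /=; rewrite stepE.
have ipow : mu.-integrable `[0, B] (EFin \o (fun t => t ^+ n.+1)).
  have := poly_integrable mu ('X^(n.+1)) B; congr (_.-integrable _ _).
  by apply/funext => t /=; rewrite hornerXn.
have itvP t : `[0, B]%classic t -> t ^+ n.+1 <= step_fun B M n t <= t ^+ n.+1 + mesh B M n.
  by rewrite /= in_itv; exact: step_fun_bounds.
have I_T : I <= T F <= I + mesh B M n.
  rewrite -intT; apply/andP; split.
    by apply: le_Rintegral => // t /itvP /andP[].
  have im : mu.-integrable `[0, B] (EFin \o (fun=> mesh B M n)).
    have := poly_integrable mu (mesh B M n)%:P B; congr (_.-integrable _ _).
    by apply/funext => t /=; rewrite hornerC.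
  have <- : \int[mu]_(t in `[0, B]) (mesh B M n) = mesh B M n.
    by rewrite Rintegral_cst //= (concentrated1 hausdorff_measure_concentrated) mulr1.
  rewrite -RintegralD //; apply: le_Rintegral => //.
    have := integrableD mB ipow im.
    by congr (_.-integrable _ _); apply/funext => t /=; rewrite EFinD.
  by move=> t /itvP /andP[].
have m_T : m <= T G <= m + mesh B M n.
  pose a N := \sum_(k < N.+2) bernstein_weight L N.+1 k * node B N k ^+ n.+1.
  pose TN N := \sum_(i < M) D i * (1 - quad_cdf L B (x i) N).
  have TNE N : TN N
      = \sum_(k < N.+2) bernstein_weight L N.+1 k * step_fun B M n (node B N k).
    rewrite /TN /step_fun; under [RHS]eq_bigr do rewrite mulr_sumr.
    rewrite exchange_big /=; apply: eq_bigr => i _.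
    rewrite -[X in D i * (X - _)](sum_bernstein_weight L_pos N.+1) /quad_cdf.
    rewrite -sumrB mulr_sumr.
    apply: eq_bigr => k _; rewrite /x; case: ltP => _; rewrite /D /=; ring.
  have aT N : a N <= TN N <= a N + mesh B M n.
    have nodeP (k : 'I_N.+2) := step_fun_bounds n B_gt0 M0 (node_itv B_gt0 k).
    rewrite TNE -[mesh B M n]mul1r -(sum_bernstein_weight L_pos N.+1) mulr_suml.
    rewrite -big_split /=; apply/andP; split; apply: ler_sum => k _; rewrite -?mulrDr;
      by rewrite ler_wpM2l ?bernstein_weight_ge0 //; case/andP: (nodeP k).
  have cvg_a : a @ nat_ultra --> m.
    apply: cvg_trans (_ : a @ \oo --> m); first by apply: cvg_app; exact: nat_ultra_sub.
    have -> : a = (fun N => B ^+ n.+1 * (\sum_(k < N.+2)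
        bernstein_weight L N.+1 k * (k%:R / N.+1%:R) ^+ n.+1)).
      apply/funext => N; rewrite mulr_sumr; apply: eq_bigr => k _.
      by rewrite /node exprMn mulrCA.
    by apply: cvgMr; exact: cvg_bernstein_moment.
  have cvg_T : TN @ nat_ultra --> T G.
    apply: cvg_big => [|i _]; first exact: add_continuous.
    apply: cvgMr; apply: cvgB; first exact: cvg_cst.
    exact: cvg_limit_cdf.
  have h1 : (fun N => TN N - a N) @ nat_ultra --> T G - m by exact: cvgB.
  have h2 : (fun N => a N + mesh B M n - TN N) @ nat_ultra --> m + mesh B M n - T G.
    by apply: cvgB => //; apply: cvgD => //; exact: cvg_cst.
  rewrite -subr_ge0 -[X in _ && X]subr_ge0; apply/andP; split.
    by apply: (cvgr_to_ge h1); apply: filterE => N; rewrite subr_ge0; case/andP: (aT N).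
  by apply: (cvgr_to_ge h2); apply: filterE => N; rewrite subr_ge0; case/andP: (aT N).
have TFG : T F <= T G.
  by apply: ler_sum => i _; rewrite ler_wpM2l // lerD2l lerN2; exact: right_cdf_ge.
have TGF : T G <= T F + mesh B M n.
  rewrite -lerBlDl -sumrB.
  (* F(x_i) <= G(x_(i+1)) and every jump is at most [mesh], so the error telescopes to [mesh] times
     an increment of G, which is at most 1. *)
  apply: (@le_trans _ _ (\sum_(i < M) mesh B M n * (G (x i.+1) - G (x i)))).
    apply: ler_sum => i _; rewrite -mulrBr.
    have -> : 1 - G (x i) - (1 - F (x i)) = F (x i) - G (x i) by ring.
    have xlt : x i < x i.+1.
      by rewrite ltr_pM2l // ltr_pM2r ?invr_gt0 ?ltr0n // ltr_nat.
    apply: ler_pM => //; first by rewrite subr_ge0 right_cdf_ge.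
      exact: grid_gap_le.
    by rewrite lerD2r right_cdf_le.
  rewrite -mulr_sumr -(big_mkord xpredT (fun i => G (x i.+1) - G (x i))).
  rewrite (telescope_sumr (fun i => G (x i))) // ler_piMr //.
    by rewrite /mesh !mulr_ge0 ?invr_ge0 ?exprn_ge0.
  by rewrite /x gridM // (limit_cdf_geB L_pos B_gt0) // lerBlDr lerDl limit_cdf_ge0.
case/andP: I_T => I1 I2; case/andP: m_T => m1 m2.
rewrite ler_norml; apply/andP; split; lra.
Qed.

End HausdorffMeasure.

Section BorelNormalization.
Variables (R : realType) (s : probability (measurableTypeR R) R).

(** Resetting the values outside the Borel sets selects the representative demanded by
    [borel_normalized]. *)
Definition borel_part (A : set (measurableTypeR R)) : \bar R :=
  if `[< measurable A >] then s A else 0%E.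

Lemma borel_partE A : measurable A -> borel_part A = s A.
Proof. by move=> mA; rewrite /borel_part asboolT. Qed.

Fact borel_part0 : borel_part set0 = 0%E.
Proof. by rewrite borel_partE // measure0. Qed.

Fact borel_part_ge0 A : (0 <= borel_part A)%E.
Proof. by rewrite /borel_part; case: ifP. Qed.

Fact borel_part_sigma_additive : semi_sigma_additive borel_part.
Proof.
move=> A mA tA mUA; rewrite borel_partE //.
have -> : (fun n => \sum_(0 <= i < n) borel_part (A i))%E
    = (fun n => \sum_(0 <= i < n) s (A i))%E.
  by apply/funext => n; apply: eq_bigr => i _; rewrite borel_partE.
exact: measure_semi_sigma_additive.
Qed.

HB.instance Definition _ := isMeasure.Build _ _ _ borel_part
  borel_part0 borel_part_ge0 borel_part_sigma_additive.

Fact borel_part_setT : borel_part setT = 1%E.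
Proof. by rewrite borel_partE // probability_setT. Qed.

HB.instance Definition _ :=
  Measure_isProbability.Build _ _ _ borel_part borel_part_setT.

Definition borel_normalization : probability (measurableTypeR R) R := borel_part.

Lemma borel_normalizationP : borel_normalized borel_normalization.
Proof. by move=> A mA; rewrite /= /borel_part asboolF. Qed.

End BorelNormalization.

Lemma hausdorff_moment_problem (R : realType) (L : {scalar {poly R}}) (B : R) :
  hausdorff_positive L -> 0 < B ->
  exists2 s : probability (measurableTypeR R) R, Pcplus s &
    forall n, \int[s]_(t in `[0, +oo[) (t ^+ n) = B ^+ n * L 'X^n.
Proof.
move=> L_pos B_gt0; pose mu := hausdorff_measure L_pos B_gt0.
have mC : measurable (~` `[0, B]%classic : set (measurableTypeR R)).
  by apply: measurableC; exact: measurable_itv.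
exists (borel_normalization mu).
  split; first exact: borel_normalizationP.
  exists `[0, B]%classic; split.
  - exact: segment_compact.
  - by apply: subset_itvl.
  - rewrite [LHS](borel_partE _ mC); exact: hausdorff_measure_concentrated.
move=> n; rewrite -(hausdorff_measure_moment L_pos B_gt0) /Rintegral; congr fine.
by apply: eq_measure_integral => A mA _; exact: borel_partE.
Qed.

(** * Moments in a C*-probability space *)

Section CStarTheory.
Variables (R : realType) (A : cstarAlgType R).
Local Notation C := R[i].
Implicit Types x y z h : A.

Lemma cnorm0 : cnorm (0 : A) = 0.
Proof.
apply: complexI; have := cnormZ (0 : C) (0 : A).
by rewrite scale0r normr0 mul0r.
Qed.

Lemma cnormZ_real (c : R) x : 0 <= c -> cnorm (c%:C%C *: x) = c * cnorm x.
Proof.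
move=> c0; apply: complexI; rewrite cnormZ rmorphM; congr (_ * _).
by rewrite ger0_norm // lecR.
Qed.

Lemma cnormN x : cnorm (- x) = cnorm x.
Proof.
apply: complexI; rewrite -scaleN1r cnormZ -[RHS]mul1r; congr (_ * _).
exact: normrN1.
Qed.

(** Nonnegativity is not an axiom of the structure: it comes from 0 = |x - x| <= 2 |x|. *)
Lemma cnorm_ge0 x : 0 <= cnorm x.
Proof.
have := cnormD x (- x); rewrite subrr cnorm0 cnormN -mulr2n.
by rewrite pmulrn_lge0.
Qed.

Lemma cnormBC x y : cnorm (x - y) = cnorm (y - x).
Proof. by rewrite -cnormN opprB. Qed.

(** The C*-identity gives |y|^2 = |y* y| <= |y*| |y|; dividing and exchanging y with y* yields
    equality. *)
Lemma cnorm_star x : cnorm (star x) = cnorm x.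
Proof.
have le_star y : cnorm y <= cnorm (star y).
  have [y0|y0] := eqVneq (cnorm y) 0; first by rewrite y0 cnorm_ge0.
  have p : 0 < cnorm y by rewrite lt_def y0 cnorm_ge0.
  by rewrite -(ler_pM2r p) -expr2 -cnorm_starM; exact: cnormM.
by apply: le_anti; rewrite le_star andbT -{2}(starK x) le_star.
Qed.

Lemma star0 : star (0 : A) = 0.
Proof. by apply: (addrI (star 0)); rewrite -starD !addr0. Qed.

Lemma star1 : star (1 : A) = 1.
Proof. by rewrite -[LHS]mulr1 -[X in _ * X]starK -starM mulr1 starK. Qed.

Lemma starN x : star (- x) = - star x.
Proof. by apply: (addrI (star x)); rewrite -starD !subrr star0. Qed.

Lemma starX x n : star (x ^+ n) = star x ^+ n.
Proof.
elim: n => [|n IH]; first by rewrite !expr0 star1.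
by rewrite exprS starM IH exprSr.
Qed.

Lemma star_real (c : R) x : star (c%:C%C *: x) = c%:C%C *: star x.
Proof.
by rewrite starZ; congr (_ *: _); apply: conj_Creal; apply/complex_realP; exists c.
Qed.

Local Notation half x := ((2^-1 : R)%:C%C *: x).

Fixpoint sqrt_iter h (n : nat) : A :=
  if n is m.+1 then half (h + sqrt_iter h m * sqrt_iter h m) else 0.

Lemma sub_sqr_le x y r : cnorm x <= r -> cnorm y <= r ->
  cnorm (x * x - y * y) <= 2 * r * cnorm (x - y).
Proof.
move=> xr yr.
have -> : x * x - y * y = x * (x - y) + (x - y) * y.
  by rewrite mulrBr mulrBl addrA subrK.
have d0 := cnorm_ge0 (x - y).
have h1 : cnorm (x * (x - y)) <= r * cnorm (x - y).
  by apply: le_trans (cnormM _ _) _; rewrite ler_wpM2r.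
have h2 : cnorm ((x - y) * y) <= r * cnorm (x - y).
  by apply: le_trans (cnormM _ _) _; rewrite mulrC ler_wpM2r.
apply: le_trans (cnormD _ _) _.
by rewrite -mulrA mulr_natl mulr2n; exact: lerD.
Qed.

Section SquareRoot.
Variable h : A.
Hypotheses (h_star : star h = h) (h_le : cnorm h <= 3 / 4).
Local Notation u := (sqrt_iter h).

Lemma sqrt_iter_star n : star (u n) = u n.
Proof.
elim: n => [|n IH] /=; first exact: star0.
by rewrite star_real starD starM IH h_star.
Qed.

(** The 3/4 is chosen so that the ball of radius 1/2 is stable: (3/4 + 1/4) / 2 = 1/2. On this ball
    squaring has Lipschitz constant 1, and the halving makes the iteration contract by 1/2. *)
Lemma sqrt_iter_le n : cnorm (u n) <= 2^-1.
Proof.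
elim: n => [|n IH] /=; first by rewrite cnorm0 invr_ge0.
rewrite cnormZ_real ?invr_ge0 //.
have h1 := cnormD h (u n * u n); have h2 := cnormM (u n) (u n).
have h3 : cnorm (u n) * cnorm (u n) <= 2^-1 * 2^-1.
  by apply: ler_pM => //; exact: cnorm_ge0.
by move: h_le h1 h2 h3; lra.
Qed.

Lemma sqrt_iter_step n m :
  cnorm (u n.+1 - u m.+1) <= 2^-1 * cnorm (u n - u m).
Proof.
rewrite /= -scalerBr opprD addrACA subrr add0r cnormZ_real ?invr_ge0 //.
rewrite ler_wpM2l ?invr_ge0 //.
have := sub_sqr_le (sqrt_iter_le n) (sqrt_iter_le m).
by rewrite mulfV ?mul1r // pnatr_eq0.
Qed.

Lemma sqrt_iter_cauchy n k : cnorm (u (n + k)%N - u n) <= 2^-1 ^+ n.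
Proof.
elim: n => [|n IH].
  rewrite add0n subr0 expr0; apply: le_trans (sqrt_iter_le _) _.
  by rewrite invf_le1 // ler1n.
rewrite addSn; apply: le_trans (sqrt_iter_step _ _) _.
by rewrite exprS ler_wpM2l ?invr_ge0.
Qed.

Lemma half_expr_lt (e : R) : 0 < e -> exists n, 2^-1 ^+ n < e.
Proof.
move=> e0; have r1 : `|2^-1 : R| < 1 by rewrite ger0_norm ?invr_ge0 // invf_lt1 // ltr1n.
move/cvgrPdist_lt: (cvg_expr r1) => /(_ _ e0)[n _ /(_ n (leqnn n))].
rewrite sub0r normrN ger0_norm ?exprn_ge0 ?invr_ge0 // => h1; by exists n.
Qed.

(* For [1 - h = y^2] with [y = 1 - z] one solves [z = (h + z^2) / 2], a
   contraction of the ball of radius 1/2. *)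
Lemma exists_sqrt : exists2 y, star y = y & y * y = 1 - h.
Proof.
have uC (e : R) : 0 < e -> exists N : nat, forall m n : nat,
    (N <= m)%N -> (N <= n)%N -> cnorm (u m - u n) < e.
  move=> e0; have e20 : 0 < e / 2 by rewrite divr_gt0.
  have [N Ne] := half_expr_lt e20; exists N => m n Nm Nn.
  have hm := sqrt_iter_cauchy N (m - N); have hn := sqrt_iter_cauchy N (n - N).
  rewrite !subnKC // in hm hn.
  have -> : u m - u n = (u m - u N) + (u N - u n) by rewrite addrA subrK.
  apply: le_lt_trans (cnormD _ _) _; rewrite [cnorm (u N - _)]cnormBC.
  by move: hm hn Ne; lra.
have [z zP] := cnorm_complete u uC.
have small x : (forall e : R, 0 < e -> cnorm x <= e) -> x = 0.
  move=> xe; apply: cnorm_eq0; apply: le_anti; rewrite cnorm_ge0 andbT.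
  by apply/ler_addgt0Pr => e e0; rewrite add0r xe.
have z_star : star z = z.
  apply/eqP; rewrite -subr_eq0; apply/eqP; apply: small => e e0.
  have e20 : 0 < e / 2 by rewrite divr_gt0.
  have [N /(_ N (leqnn N)) Ne] := zP _ e20.
  have -> : star z - z = star (z - u N) + (u N - z).
    by rewrite starD starN sqrt_iter_star addrA subrK.
  apply: le_trans (cnormD _ _) _; rewrite cnorm_star cnormBC.
  by move: Ne; lra.
have z_le : cnorm z <= 2.
  have [N /(_ N (leqnn N)) Ne] := zP 1 ltr01.
  have -> : z = (z - u N) + u N by rewrite subrK.
  apply: le_trans (cnormD _ _) _; rewrite cnormBC.
  by have := sqrt_iter_le N; move: Ne; lra.
have z_fix : z - half (h + z * z) = 0.
  (* On the ball of radius 2 squaring has Lipschitz constant 4, so the error is at most e/8 + (1/2)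
     4 (e/8) < e. *)
  apply: small => e e0; have e80 : 0 < e / 8 by rewrite divr_gt0.
  have [N Ne] := zP _ e80.
  have -> : z - half (h + z * z) = (z - u N.+1) + half (u N * u N - z * z).
    rewrite [u N.+1]/= -[RHS]addrA; congr (z + _).
    rewrite -!scalerN -scalerDr; congr (_ *: _).
    by rewrite !opprD -[RHS]addrA; congr (- h + _); rewrite addKr.
  apply: le_trans (cnormD _ _) _; rewrite cnormZ_real ?invr_ge0 // cnormBC.
  have h1 := Ne _ (leqnSn N); have h2 := Ne _ (leqnn N).
  have uN2 : cnorm (u N) <= 2 by have := sqrt_iter_le N; lra.
  have := sub_sqr_le uN2 z_le.
  by move: h1 h2; have := cnorm_ge0 (u N - z); lra.
exists (1 - z); first by rewrite starD starN star1 z_star.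
have zz : z + z = h + z * z.
  have /eqP := z_fix; rewrite subr_eq0 => /eqP e.
  rewrite {1 2}e -scalerDl -rmorphD /=.
  have -> : 2^-1 + 2^-1 = 1 :> R by field.
  by rewrite scale1r.
have -> : (1 - z) * (1 - z) = 1 - (z + z) + z * z.
  by rewrite mulrBr mulr1 mulrBl mul1r opprB opprD !addrA addrAC.
by rewrite zz opprD -!addrA addNr addr0.
Qed.

End SquareRoot.
End CStarTheory.

(** * Positivity of the moment functional of a state *)

Section PositiveMoments.
Variables (R : realType) (P : cstar_prob_space R) (b y : P).
Local Notation C := R[i].
Local Notation phi := (cps_state P).
Local Notation h := (star b * b).
Hypothesis y_sqr : star y * y = 1 - h.

Definition poly_calc (p : {poly R}) : P := horner_alg h (map_poly (real_complex R) p).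

HB.instance Definition _ := GRing.RMorphism.copy poly_calc
  (horner_alg h \o map_poly (real_complex R)).

Lemma poly_calcX : poly_calc 'X = h.
Proof. by rewrite /poly_calc map_polyX horner_algX. Qed.

Lemma poly_calcZ c p : poly_calc (c *: p) = c%:C%C *: poly_calc p.
Proof.
have cE : poly_calc c%:P = c%:C%C *: 1 by rewrite /poly_calc map_polyC horner_algC.
rewrite -mul_polyC [LHS]rmorphM /=.
by rewrite [X in X * _]cE -scalerAl mul1r.
Qed.

Lemma poly_calc_star p : star (poly_calc p) = poly_calc p.
Proof.
have hh : star h = h by rewrite starM starK.
rewrite -[p]coefK poly_def raddf_sum (big_morph _ (@starD _ _) (star0 _)).
apply: eq_bigr => i _.
by rewrite /= poly_calcZ star_real rmorphXn /= poly_calcX starX hh.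

Qed.

(** Polynomials in h with real coefficients are self-adjoint and commute, so c(h) p(h)^2 is x* x
    with x = d p(h). *)
Lemma poly_calc_sqr_ge0 (d : P) (c p : {poly R}) : star d * d = poly_calc c ->
  0 <= phi (poly_calc (c * p ^+ 2)).
Proof.
move=> dc; have -> : poly_calc (c * p ^+ 2) = star (d * poly_calc p) * (d * poly_calc p).
  rewrite starM poly_calc_star mulrA -[_ * _ * d]mulrA dc -!rmorphM.
  by congr (poly_calc _); ring.
exact: cps_state_ge0.
Qed.

(** Even powers are squares, so only the parities matter. When both exponents are odd, X (1 - X) =
    (1 - X) X^2 + X (1 - X)^2 reduces to the two factors h and 1 - h known to be of the form d*
    d. *)
Lemma poly_calc_ge0 k j : 0 <= phi (poly_calc ('X ^+ k * (1 - 'X) ^+ j)).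
Proof.
pose p : {poly R} := 'X ^+ k./2 * (1 - 'X) ^+ j./2.
have -> : 'X ^+ k * (1 - 'X) ^+ j
    = 'X ^+ odd k * (1 - 'X) ^+ odd j * p ^+ 2 :> {poly R}.
  rewrite /p exprMn -!exprM !muln2 mulrACA -!exprD !odd_double_half //.
have bX : star b * b = poly_calc 'X by rewrite poly_calcX.
have yX : star y * y = poly_calc (1 - 'X) by rewrite rmorphB rmorph1 /= poly_calcX.
have d1 : star (1 : P) * 1 = poly_calc 1 by rewrite star1 mulr1 rmorph1.
case: (odd k); case: (odd j); rewrite ?expr0 ?expr1 ?mul1r ?mulr1.
- have -> : 'X * (1 - 'X) * p ^+ 2
     = (1 - 'X) * ('X * p) ^+ 2 + 'X * ((1 - 'X) * p) ^+ 2 by ring.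
  rewrite !raddfD; apply: addr_ge0.
    exact: poly_calc_sqr_ge0 yX.
  exact: poly_calc_sqr_ge0 bX.
- exact: poly_calc_sqr_ge0 bX.
- exact: poly_calc_sqr_ge0 yX.
- by rewrite -[p ^+ 2]mul1r; exact: poly_calc_sqr_ge0 d1.
Qed.

Definition state_functional (p : {poly R}) : R := complex.Re (phi (poly_calc p)).

Fact state_functional_is_scalar : scalar state_functional.
Proof.
move=> c p q; rewrite /state_functional.
have -> : poly_calc (c *: p + q) = c%:C%C *: poly_calc p + poly_calc q.
  by rewrite -poly_calcZ; exact: rmorphD.
have -> : phi (c%:C%C *: poly_calc p + poly_calc q)
    = c%:C%C * phi (poly_calc p) + phi (poly_calc q) by exact: linearP.
rewrite [LHS]raddfD; congr (_ + _).
by rewrite [LHS]ReM /= mul0r subr0.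
Qed.

HB.instance Definition _ := GRing.isLinear.Build R {poly R} R *%R
  state_functional state_functional_is_scalar.

Lemma state_functional_pos : hausdorff_positive state_functional.
Proof.
split; first by rewrite /= /state_functional rmorph1 cps_state1.
by move=> k j; have := poly_calc_ge0 k j; rewrite lecE => /andP[].
Qed.

Lemma state_functionalE n : phi (h ^+ n) = (state_functional 'X^n)%:C%C.
Proof.
have := poly_calc_ge0 n 0; rewrite expr0 mulr1 /state_functional => p0.
by rewrite RRe_real ?ger0_real // rmorphXn /= poly_calcX.
Qed.

End PositiveMoments.

Lemma state_moments (R : realType) (P : cstar_prob_space R) (a : P) :
  exists2 s : probability (measurableTypeR R) R, Pcplus s &
    forall n, cps_state P ((a * star a) ^+ n)
      = (\int[s]_(t in `[0, +oo[) (t ^+ n))%:C%C.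
Proof.
(* The factor 2 makes the norm of aa*/B at most 1/2, below the 3/4 required by [exists_sqrt]; adding
   1 keeps [B] positive when a = 0. *)
pose B : R := 2 * cnorm (a * star a) + 1.
have g0 := cnorm_ge0 (a * star a).
have B0 : 0 < B by rewrite ltr_wpDl // mulr_ge0.
pose b : P := ((Num.sqrt B)^-1)%:C%C *: star a.
have bE : star b * b = (B^-1)%:C%C *: (a * star a).
  rewrite /b star_real starK -scalerAl -scalerAr scalerA -rmorphM -invfM.
  by rewrite -expr2 sqr_sqrtr // ltW.
have b_star : star (star b * b) = star b * b by rewrite starM starK.
have b_le : cnorm (star b * b) <= 3 / 4.
  rewrite bE cnormZ_real ?invr_ge0 ?(ltW B0) //.
  by rewrite mulrC ler_pdivrMr // /B; lra.
have [y y_star yy] := exists_sqrt b_star b_le.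
have y_sqr : star y * y = 1 - star b * b by rewrite y_star.
have L_pos := state_functional_pos y_sqr.
have [s sP sm] := hausdorff_moment_problem L_pos B0.
exists s => // n; rewrite sm rmorphM.
have -> : a * star a = B%:C%C *: (star b * b).
  by rewrite bE scalerA -rmorphM divff ?gt_eqF // scale1r.
rewrite exprZn; transitivity (B%:C%C ^+ n * cps_state P ((star b * b) ^+ n)).
  exact: linearZ_LR.
by rewrite rmorphXn (state_functionalE y_sqr).
Qed.

(** * The parametrization *)

Section Parametrization.
Variable R : realType.
Implicit Types (s : probability (measurableTypeR R) R) (mu : {scalar ncpoly R}).

Lemma Dc1 mu : Dc mu -> mu 1 = 1.
Proof. by case=> P [a []]. Qed.

Lemma common_support s s' : Pcplus s -> Pcplus s' ->
  exists B, [/\ 0 < B, concentrated s B & concentrated s' B].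
Proof.
move=> /Pcplus_concentrated[B B0 sB] /Pcplus_concentrated[B' B0' sB'].
exists (Num.max B B'); split; first by rewrite lt_max B0.
  by apply: sB; rewrite le_max lexx.
by apply: sB'; rewrite le_max lexx orbT.
Qed.

Lemma eta_diagonal_realization s1 s2 : Pcplus s1 -> Pcplus s2 ->
  exists mu, [/\ Dc mu, eta_diagonal mu,
    has_moments mu (ncZ R * ncZs R) s1 & has_moments mu (ncZs R * ncZ R) s2].
Proof.
move=> p1 p2; have [B [B0 s1B s2B]] := common_support p1 p2.
have [mu [muD mue mu1 mu2]] := eta_diagonal_exists
  (moment_functional_pos B0 s1B) (moment_functional_pos B0 s2B) (ltW B0).
exists mu; split; [exact: muD | exact: mue | move=> n | move=> n].
  by apply: etrans (mu1 n) _; rewrite (moment_functionalE B0 s1B).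
by apply: etrans (mu2 n) _; rewrite (moment_functionalE B0 s2B).
Qed.

Lemma eta_diagonal_has_moments_unique mu mu' s1 s2 :
  Dc mu -> eta_diagonal mu ->
  has_moments mu (ncZ R * ncZs R) s1 -> has_moments mu (ncZs R * ncZ R) s2 ->
  Dc mu' -> eta_diagonal mu' ->
  has_moments mu' (ncZ R * ncZs R) s1 -> has_moments mu' (ncZs R * ncZ R) s2 ->
  mu = mu'.
Proof.
move=> D e m1 m2 D' e' m1' m2'.
apply: (eta_diagonal_unique (Dc1 D) (Dc1 D') e e') => n.
  exact: etrans (m1 n) (esym (m1' n)).
exact: etrans (m2 n) (esym (m2' n)).
Qed.

Lemma has_moments_unique mu (p : ncpoly R) s s' : Pcplus s -> Pcplus s' ->
  has_moments mu p s -> has_moments mu p s' -> s = s'.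
Proof.
move=> ps ps' ms ms'; have [B [B0 sB sB']] := common_support ps ps'.
have [bs _] := ps; have [bs' _] := ps'.
apply: probability_ext => A; have [mA|mA] := pselect (measurable A); last first.
  by rewrite bs // bs'.
apply: (probability_moments_unique sB sB' B0) => // n.
by apply: complexI; exact: etrans (esym (ms n)) (ms' n).
Qed.

Lemma Dc_has_moments mu : Dc mu -> exists s1 s2, [/\ Pcplus s1, Pcplus s2,
  has_moments mu (ncZ R * ncZs R) s1 & has_moments mu (ncZs R * ncZ R) s2].
Proof.
case=> P [a [mu1 amu]].
have muE w : mu (wpow (ncZ R) (ncZs R) w) = cps_state P (wpow a (star a) w).
  have [->|w0] := eqVneq w [::]; last exact: amu.
  by rewrite !wpow_nil mu1 cps_state1.
(* The second measure comes from the same result for a*, because a* a** = a* a. *)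
have [s1 p1 m1] := state_moments a; have [s2 p2 m2] := state_moments (star a).
exists s1, s2; split; [exact: p1 | exact: p2 | move=> n | move=> n].
  rewrite -wpow_altl; apply: etrans (muE _) _; rewrite wpow_altl; exact: m1.
rewrite -wpow_altr; apply: etrans (muE _) _; rewrite wpow_altr.
by have := m2 n; rewrite starK.
Qed.

End Parametrization.

Theorem theorem5p2 (R : realType) :
  (forall s1 s2 : probability (measurableTypeR R) R,
     Pcplus s1 -> Pcplus s2 ->
     exists! mu : {scalar ncpoly R},
       [/\ Dc mu, eta_diagonal mu,
           has_moments mu (ncZ R * ncZs R) s1
         & has_moments mu (ncZs R * ncZ R) s2]) /\
  (exists Phi : probability (measurableTypeR R) R *
                probability (measurableTypeR R) R -> {scalar ncpoly R},
     (forall s1 s2 : probability (measurableTypeR R) R,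
        Pcplus s1 -> Pcplus s2 ->
        [/\ Dc (Phi (s1, s2)), eta_diagonal (Phi (s1, s2)),
            has_moments (Phi (s1, s2)) (ncZ R * ncZs R) s1
          & has_moments (Phi (s1, s2)) (ncZs R * ncZ R) s2]) /\
     set_bij (@Pcplus R `*` @Pcplus R)
       [set mu : {scalar ncpoly R} | Dc mu /\ eta_diagonal mu] Phi).
Proof.
split=> [s1 s2 p1 p2|].
  have [mu muP] := eta_diagonal_realization p1 p2.
  exists mu; split=> // mu' [D' e' m1' m2']; have [D e m1 m2] := muP.
  exact: eta_diagonal_has_moments_unique m1 m2 D' e' m1' m2'.
(* Membership in [Pcplus] is placed inside the relation to make it total, as [choice] demands; on
   other pairs [Phi] takes arbitrary values. *)
pose Q (p : probability (measurableTypeR R) R * probability (measurableTypeR R) R)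
    (mu : {scalar ncpoly R}) := Pcplus p.1 -> Pcplus p.2 ->
  [/\ Dc mu, eta_diagonal mu, has_moments mu (ncZ R * ncZs R) p.1
    & has_moments mu (ncZs R * ncZ R) p.2].
have Q_total p : exists mu, Q p mu.
  have [[p1 p2]|np] := pselect (Pcplus p.1 /\ Pcplus p.2).
    by have [mu muP] := eta_diagonal_realization p1 p2; exists mu.
  by exists (word_functional (fun=> 0)) => p1 p2; case: np.
have [Phi PhiP] := choice Q_total.
exists Phi; split=> [s1 s2 p1 p2|]; first exact: PhiP.
split.
- by move=> [s1 s2] [/= p1 p2]; have [D e _ _] := PhiP (s1, s2) p1 p2.
- move=> [s1 s2] [t1 t2]; rewrite !inE => -[/= p1 p2] [/= q1 q2] eP.
  have [_ _ m1 m2] := PhiP (s1, s2) p1 p2; have [_ _] := PhiP (t1, t2) q1 q2.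
  rewrite -eP /= => n1 n2; congr (_, _).
    exact: has_moments_unique m1 n1.
  exact: has_moments_unique m2 n2.
(* Surjectivity: [Phi] at the measures of ZZ* and Z*Z under [mu] shares their moments with [mu],
   hence equals it by uniqueness. *)
- move=> mu [D e]; have [s1 [s2 [p1 p2 m1 m2]]] := Dc_has_moments D.
  exists (s1, s2) => //; have [D' e' m1' m2'] := PhiP (s1, s2) p1 p2.
  exact: eta_diagonal_has_moments_unique m1' m2' D e m1 m2.
Qed.
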